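(* Let $0<p<\infty$, let the Lévy measure $\nu$ of $L$ satisfy $\int_{|z|>1}|z|^p\nu(dz)<\infty$, and let $\mathcal{Q}$ be a real $d\times d$ matrix all of whose eigenvalues have positive real parts. Let $x\in\mathbb{R}^d$, $x\ne0$, with spectral data $\mathfrak{q}>0$, $\ell\in\{1,\ldots,d\}$ (see context), let $\mathfrak{t}^x_\varepsilon=\frac1{\mathfrak{q}}|\ln(\varepsilon)|+\frac{\ell-1}{\mathfrak{q}}\ln(|\ln(\varepsilon)|)$ and $w_\varepsilon\to w>0$ as $\varepsilon\to0$. Then for any $0<p'\le p$, $$\lim_{r\to\infty}\liminf_{\varepsilon\to0}\frac1{\varepsilon^{p'}}\mathbb{E}\big[|X^\varepsilon_{\mathfrak{t}^x_\varepsilon+r\cdot w_\varepsilon}(x)|^{p'}\big]=\lim_{r\to\infty}\limsup_{\varepsilon\to0}\frac1{\varepsilon^{p'}}\mathbb{E}\big[|X^\varepsilon_{\mathfrak{t}^x_\varepsilon+r\cdot w_\varepsilon}(x)|^{p'}\big]=\mathbb{E}\big[|\mathcal{O}_\infty|^{p'}\big]$$ and $$\lim_{r\to-\infty}\liminf_{\varepsilon\to0}\frac1{\varepsilon^{p'}}\mathbb{E}\big[|X^\varepsilon_{\mathfrak{t}^x_\varepsilon+r\cdot w_\varepsilon}(x)|^{p'}\big]=\lim_{r\to-\infty}\limsup_{\varepsilon\to0}\frac1{\varepsilon^{p'}}\mathbb{E}\big[|X^\varepsilon_{\mathfrak{t}^x_\varepsilon+r\cdot w_\varepsilon}(x)|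^{p'}\big]=\infty.$$
   Context: $L=(L_t)_{t\ge0}$ is a Lévy process in $\mathbb{R}^d$ (stationary independent increments, $L_0=0$, càdlàg paths) with Lévy triplet $(b,\Sigma,\nu)$. For $\varepsilon>0$, $X^\varepsilon_\cdot(x)$ is the unique strong solution of $dX^\varepsilon_t=-\mathcal{Q}X^\varepsilon_t\,dt+\varepsilon\,dL_t$, $X^\varepsilon_0=x$. Thus $X^\varepsilon_t(x)=e^{-\mathcal{Q}t}x+\varepsilon\mathcal{O}_t$ with $\mathcal{O}_t=\int_0^te^{-\mathcal{Q}(t-s)}dL_s:=L_t-\int_0^te^{-\mathcal{Q}(t-s)}\mathcal{Q}L_s\,ds$. As $t\to\infty$, $\mathcal{O}_t$ converges in distribution to a random vector $\mathcal{O}_\infty$. Spectral data of $x$. For such $\mathcal{Q}$ and $x\ne0$ there exist $\mathfrak{q}=\mathfrak{q}(x)>0$, $\ell=\ell(x),m=m(x)\in\{1,\ldots,d\}$, angles $\theta_1,\ldots,\theta_m\in\mathbb{R}$ and linearly independent $v_1,\ldots,v_m\in\mathbb{C}^d$ such that $$\lim_{t\to\infty}\Big|\frac{e^{\mathfrak{q}t}}{t^{\ell-1}}e^{-\mathcal{Q}t}x-\sum_{k=1}^me^{it\theta_k}v_k\Big|=0,\qquad 0<\liminf_{t\to\infty}\Big|\sum_{k=1}^me^{it\theta_k}v_k\Big|\le\limsup_{t\to\infty}\Big|\sum_{k=1}^me^{it\theta_k}v_k\Big|\le\sum_{k=1}^m|v_k|.$$ The numbers $\mathfrak{q}\pm i\theta_k$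 are eigenvalues of $\mathcal{Q}$ and the $v_k$ are generalized eigenvectors of $\mathcal{Q}$. *)

(* Defs.v *)
From HB Require Import structures.
From mathcomp Require Import all_boot all_order all_algebra.
From mathcomp Require Import complex.
From mathcomp Require Import all_classical all_reals all_analysis.

Set Implicit Arguments.
Unset Strict Implicit.
Unset Printing Implicit Defensive.

Import Order.TTheory GRing.Theory Num.Theory.
Import numFieldNormedType.Exports.
Local Open Scope classical_set_scope.
Local Open Scope complex_scope.
Local Open Scope ring_scope.

(* [enorm] is the Euclidean norm: the library's norm on matrices is the sup
   norm (its topology is the usual one). *)
Definition enorm (R : realType) (d : nat) (x : 'cV[R]_d) : R :=
  Num.sqrt (\sum_(i < d) x i 0 ^+ 2).

Definition cnorm (R : realType) (d : nat) (v : 'cV[R[i]]_d) : R :=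
  Num.sqrt (\sum_(i < d) (complex.Re (v i 0) ^+ 2 + complex.Im (v i 0) ^+ 2)).

Definition dotv (R : realType) (d : nat) (x y : 'cV[R]_d) : R :=
  \sum_(i < d) x i 0 * y i 0.

Definition cmx (R : realType) (m n : nat) (A : 'M[R]_(m, n)) : 'M[R[i]]_(m, n) :=
  map_mx (real_complex R) A.

Definition cexp (R : realType) (z : R[i]) : R[i] :=
  (expR (complex.Re z) * cos (complex.Im z)) +i*
  (expR (complex.Re z) * sin (complex.Im z)).

Definition expmx (R : realType) (d : nat) (A : 'M[R]_d) : 'M[R]_d :=
  \matrix_(i, j) limn (series (fun n => (n`!%:R^-1 *: A ^+ n) i j)).

(* R^d with its Borel sigma-algebra; convertible to 'cV[R]_d. *)
Definition borel_vec (R : realType) (d : nat) :=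
  g_sigma_algebraType (@open 'cV[R]_d).

Definition random_vec (R : realType) (d : nat) (dT : measure_display)
    (T : measurableType dT) (X : T -> 'cV[R]_d) : Prop :=
  measurable_fun [set: T] (X : T -> borel_vec R d).

Definition cadlag (R : realType) (d : nat) (f : R -> 'cV[R]_d) : Prop :=
  (forall t : R, 0 <= t -> f s @[s --> t^'+] --> f t) /\
  (forall t : R, 0 < t -> cvg (f s @[s --> t^'-])).

Definition vint (R : realType) (d : nat) (t : R) (f : R -> 'cV[R]_d) : 'cV[R]_d :=
  \col_(i < d) \int[lebesgue_measure]_(s in `[0, t]) f s i 0.

Definition cvg_in_distribution (R : realType) (d : nat)
    (dT : measure_display) (T : measurableType dT) (P : probability T R)
    (dT' : measure_display) (T' : measurableType dT') (P' : probability T' R)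
    (X : R -> T -> 'cV[R]_d) (Y : T' -> 'cV[R]_d) : Prop :=
  forall f : 'cV[R]_d -> R, continuous f -> (exists M : R, forall x, `|f x| <= M) ->
    ('E_P[fun w => f (X t w)] @[t --> +oo%R] --> 'E_P'[fun w => f (Y w)])%E.

Definition increment (R : realType) (d : nat) (T : Type)
    (L : R -> T -> 'cV[R]_d) (s t : R) (w : T) : 'cV[R]_d := L t w - L s w.

(* Processes are indexed by all of R; only times t >= 0 matter. *)
Record levy_process (R : realType) (d : nat) (dT : measure_display)
    (T : measurableType dT) (P : probability T R)
    (L : R -> T -> 'cV[R]_d) : Prop := LevyProcess {
  levy_random : forall t : R, 0 <= t -> random_vec (L t) ;
  levy_start : forall w, L 0 w = 0 ;
  levy_cadlag : forall w, cadlag (fun t => L t w) ;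
  levy_stationary : forall (s t : R) (A : set (borel_vec R d)),
    0 <= s -> 0 <= t -> measurable A ->
    P (increment L s (s + t) @^-1` A) = P (L t @^-1` A) ;
  (* The product rule for subfamilies is obtained by taking A i = setT. *)
  levy_independent : forall (n : nat) (t : nat -> R)
      (A : 'I_n -> set (borel_vec R d)),
    0 <= t 0%N -> (forall i, t i <= t i.+1) -> (forall i, measurable (A i)) ->
    P (\bigcap_(i in [set: 'I_n]) (increment L (t i) (t i.+1) @^-1` A i)) =
    (\prod_(i < n) P (increment L (t i) (t i.+1) @^-1` A i))%E }.

Record levy_measure (R : realType) (d : nat)
    (nu : {measure set (borel_vec R d) -> \bar R}) : Prop := LevyMeasure {
  levy_measure0 : nu [set 0 : 'cV[R]_d] = 0%E ;
  levy_measure_fin :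
    (\int[nu]_z (Num.min 1 (enorm (z : 'cV[R]_d) ^+ 2))%:E < +oo)%E }.

(* i<b,u> - <u,Sigma u>/2 + \int (e^{i<u,z>} - 1 - i<u,z>1_{|z|<=1}) nu(dz),
   with the integral split into real and imaginary parts. *)
Definition levy_exponent (R : realType) (d : nat) (b : 'cV[R]_d)
    (Sigma : 'M[R]_d) (nu : {measure set (borel_vec R d) -> \bar R})
    (u : 'cV[R]_d) : R[i] :=
  (- (2^-1 * dotv u (Sigma *m u)) +
     \int[nu]_(z in [set: borel_vec R d]) (cos (dotv u z) - 1)) +i*
  (dotv b u +
     \int[nu]_(z in [set: borel_vec R d])
       (sin (dotv u z) - (if enorm (z : 'cV[R]_d) <= 1 then dotv u z else 0))).

Definition char_fun (R : realType) (d : nat) (dT : measure_display)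
    (T : measurableType dT) (P : probability T R) (X : T -> 'cV[R]_d)
    (u : 'cV[R]_d) : R[i] :=
  (\int[P]_(w in [set: T]) cos (dotv u (X w))) +i*
  (\int[P]_(w in [set: T]) sin (dotv u (X w))).

Record levy_triplet (R : realType) (d : nat) (dT : measure_display)
    (T : measurableType dT) (P : probability T R) (L : R -> T -> 'cV[R]_d)
    (b : 'cV[R]_d) (Sigma : 'M[R]_d)
    (nu : {measure set (borel_vec R d) -> \bar R}) : Prop := LevyTriplet {
  triplet_sym : Sigma^T = Sigma ;
  triplet_psd : forall u : 'cV[R]_d, 0 <= dotv u (Sigma *m u) ;
  triplet_nu : levy_measure nu ;
  triplet_khintchine : forall (t : R) (u : 'cV[R]_d), 0 <= t ->
    char_fun P (L t) u = cexp (t%:C * levy_exponent b Sigma nu u) }.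

(* dX = - Q X dt + eps dL, X_0 = x, in integral form. *)
Record OU_solution (R : realType) (d : nat) (dT : measure_display)
    (T : measurableType dT) (P : probability T R) (L : R -> T -> 'cV[R]_d)
    (Q : 'M[R]_d) (eps : R) (x : 'cV[R]_d)
    (X : R -> T -> 'cV[R]_d) : Prop := OUSolution {
  OU_random : forall t : R, 0 <= t -> random_vec (X t) ;
  OU_path : {ae P, forall w, cadlag (fun t => X t w) /\
    forall t : R, 0 <= t ->
      X t w = x - vint t (fun s => Q *m X s w) + eps *: L t w} }.

(* O_t, the stochastic convolution \int_0^t e^{-Q(t-s)} dL_s. *)
Definition OU_conv (R : realType) (d : nat) (T : Type)
    (Q : 'M[R]_d) (L : R -> T -> 'cV[R]_d) (t : R) (w : T) : 'cV[R]_d :=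
  L t w - vint t (fun s => expmx (- (t - s) *: Q) *m (Q *m L s w)).

Definition trig_sum (R : realType) (d m : nat) (theta : 'I_m -> R)
    (v : 'I_m -> 'cV[R[i]]_d) (t : R) : 'cV[R[i]]_d :=
  \sum_(k < m) cexp (0 +i* (t * theta k)) *: v k.

Record spectral_data (R : realType) (d : nat) (Q : 'M[R]_d) (x : 'cV[R]_d)
    (q : R) (l m : nat) (theta : 'I_m -> R)
    (v : 'I_m -> 'cV[R[i]]_d) : Prop := SpectralData {
  spectral_q : 0 < q ;
  spectral_l : (1 <= l <= d)%N ;
  spectral_m : (1 <= m <= d)%N ;
  spectral_free : free [tuple v k | k < m] ;
  spectral_cvg :
    cnorm ((expR (q * t) / t ^+ l.-1)%:C *: cmx (expmx (- t *: Q) *m x)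
           - trig_sum theta v t) @[t --> +oo] --> (0 : R) ;
  spectral_liminf :
    (0 < limf_einf (fun t => (cnorm (trig_sum theta v t))%:E) (pinfty_nbhs R))%E ;
  spectral_inf_sup :
    (limf_einf (fun t => (cnorm (trig_sum theta v t))%:E) (pinfty_nbhs R) <=
     limf_esup (fun t => (cnorm (trig_sum theta v t))%:E) (pinfty_nbhs R))%E ;
  spectral_limsup :
    (limf_esup (fun t => (cnorm (trig_sum theta v t))%:E) (pinfty_nbhs R) <=
     (\sum_(k < m) cnorm (v k))%:E)%E ;
  spectral_eigenvalue : forall k,
    eigenvalue (cmx Q) (q +i* theta k) /\ eigenvalue (cmx Q) (q -i* theta k) ;
  spectral_eigenvector : forall k, exists (lam : R[i]) (n : nat),
    v k != 0 /\ (cmx Q - lam%:M) ^+ n *m v k = 0 }.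

Definition mixing_time (R : realType) (q : R) (l : nat) (eps : R) : R :=
  q^-1 * `|ln eps| + (l.-1%:R / q) * ln `|ln eps|.

Definition rescaled_moment (R : realType) (d : nat) (dT : measure_display)
    (T : measurableType dT) (P : probability T R) (X : R -> R -> T -> 'cV[R]_d)
    (p q : R) (l : nat) (w : R -> R) (r eps : R) : \bar R :=
  (((eps `^ p)^-1)%:E *
   'E_P[fun om => (enorm (X eps (mixing_time q l eps + r * w eps) om) `^ p)%R])%E.

(* Main.v *)
Require Import Defs.
From HB Require Import structures.
From mathcomp Require Import all_boot all_order all_algebra.
From mathcomp Require Import complex.
From mathcomp Require Import all_classical all_reals all_analysis.
From mathcomp Require Import measurable_realfun.
From mathcomp Require Import ring lra.

(* Almost surely X^eps_t / eps = e^{-tQ} x / eps + O_t.  At the time t_eps + r w_eps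
   the spectral data show that the deterministic vector has norm comparable, for
   eps small, to e^{-q r w}: it vanishes as r -> +oo and explodes as r -> -oo.
   It remains to study the moments of a + O_t, for a small or large vector a.

   Lower bounds follow from weak convergence and monotone approximation by
   bounded continuous functions.  For the upper bound we may assume that
   E |O_oo|^p' is finite, and need the uniform integrability of |O_t|^p' for
   large t.  Write O_{s+t} = V + U, where U has the law of O_t and V depends only
   on the path of L up to time s, hence is independent of U.  As a difference of
   two tight families V is tight, so that the tail of |O_t| is bounded by twice
   the (shifted) tail of |O_{s+t}|; letting s -> +oo bounds it by the tail of
   |O_oo|.

   The decomposition O_{s+t} = V + U and the independence are obtained by
   approximating the integrals by Riemann sums, which are linear in finitely many
   increments of L, and by rounding these increments to finitely many values. *)

Set Implicit Arguments.
Unset Strict Implicit.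
Unset Printing Implicit Defensive.

Import Order.TTheory GRing.Theory Num.Theory.
Import numFieldNormedType.Exports.
Local Open Scope classical_set_scope.
Local Open Scope ring_scope.

(** The vector e^{-tQ} x / eps need not converge along the time scale, since its leading part is an
    oscillating trigonometric sum; only its norm is controlled, between two constants. All moment
    estimates are therefore uniform over shifts [a] of small (or large) norm, with thresholds in [t]
    that do not depend on [a].

    Weak convergence gives access to bounded continuous test functions only. This forces cutoffs
    with a ramp and truncated powers: the comparison of tails is written for a bounded continuous
    nondecreasing [h], so that [s] can tend to infinity, and the truncation is removed afterwards.

    Independence is given for rectangles in finitely many increments. Coordinatewise rounding has
    rectangles as fibres, so expectations of rounded functionals factor without a monotone class
    argument. The same limits yield the measurability of functions of O_t, which is not among the
    hypotheses.

    The formula for X^eps comes from an integration by parts proved with Fubini's theorem, because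
    the primitive of a cadlag function need not be differentiable everywhere. *)

Lemma near_ge_nat (R : realType) (x : R) : \forall n \near \oo, x <= n%:R.
Proof.
near=> n; rewrite ltW//; apply: lt_le_trans (truncnS_gt _) _; rewrite ler_nat.
by near: n; exact: nbhs_infty_ge.
Unshelve. all: by end_near. Qed.

Lemma cvg_sumr (R : realType) (U I : Type) (F : set_system U) (FF : Filter F)
    (r : seq I) (f : I -> U -> R) (l : I -> R) :
  (forall i, f i x @[x --> F] --> l i) ->
  \sum_(i <- r) f i x @[x --> F] --> \sum_(i <- r) l i.
Proof.
move=> fl; elim: r => [|i r IH].
  by rewrite big_nil; under eq_fun do rewrite big_nil; exact: cvg_cst.
by rewrite big_cons; under eq_fun do rewrite big_cons; exact: cvgD.
Qed.

(** * Bounded measurable functions and Borel maps *)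

Section BoundedIntegrals.
Context d (T : measurableType d) (R : realType).
Implicit Types (D : set T) (f g : T -> R).

Definition bounded_measurable D f :=
  measurable_fun D f /\ exists M : R, forall x, D x -> `|f x| <= M.

Lemma bounded_measurable_integrable (mu : {measure set T -> \bar R}) D f :
  measurable D -> (mu D < +oo)%E -> bounded_measurable D f ->
  mu.-integrable D (EFin \o f).
Proof.
move=> mD fD [mf [M fM]]; apply: measurable_bounded_integrable => //.
exists M; split; first exact: num_real.
by move=> y My x Dx; exact: le_trans (fM _ Dx) (ltW My).
Qed.

Lemma bounded_measurable_cst D (c : R) : bounded_measurable D (cst c).
Proof. by split; [exact: measurable_cst | exists `|c|]. Qed.

Lemma bounded_measurableD D f g : bounded_measurable D f ->
  bounded_measurable D g -> bounded_measurable D (fun x => f x + g x).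
Proof.
move=> [mf [M fM]] [mg [N gN]]; split; first exact: measurable_funD.
exists (M + N) => x Dx; apply: le_trans (ler_normD _ _) _.
by apply: lerD; [exact: fM | exact: gN].
Qed.

Lemma bounded_measurableM D f g : bounded_measurable D f ->
  bounded_measurable D g -> bounded_measurable D (fun x => f x * g x).
Proof.
move=> [mf [M fM]] [mg [N gN]]; split; first exact: measurable_funM.
exists (M * N) => x Dx; rewrite normrM.
by apply: ler_pM => //; [exact: fM | exact: gN].
Qed.

Lemma bounded_measurableB D f g : bounded_measurable D f ->
  bounded_measurable D g -> bounded_measurable D (fun x => f x - g x).
Proof.
move=> bf bg; under eq_fun do rewrite -mulN1r.
exact: (bounded_measurableD bf
  (bounded_measurableM (bounded_measurable_cst D (-1)) bg)).
Qed.

Lemma bounded_measurable_sum D (I : Type) (r : seq I) (F : I -> T -> R) :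
  (forall i, bounded_measurable D (F i)) ->
  bounded_measurable D (fun x => \sum_(i <- r) F i x).
Proof.
move=> bF; elim: r => [|i r IH].
  by under eq_fun do rewrite big_nil; exact: bounded_measurable_cst.
by under eq_fun do rewrite big_cons; exact: bounded_measurableD.
Qed.

Lemma Rintegral_sum (mu : {measure set T -> \bar R}) D (I : Type) (r : seq I)
    (F : I -> T -> R) :
  measurable D -> (mu D < +oo)%E -> (forall i, bounded_measurable D (F i)) ->
  \int[mu]_(x in D) (\sum_(i <- r) F i x) =
  \sum_(i <- r) \int[mu]_(x in D) F i x.
Proof.
move=> mD fD bF; elim: r => [|i r IH].
  under eq_Rintegral do rewrite big_nil.
  by rewrite Rintegral_cst// mul0r big_nil.
under eq_Rintegral do rewrite big_cons.
rewrite RintegralD ?IH ?big_cons//; apply: bounded_measurable_integrable => //.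
exact: bounded_measurable_sum.
Qed.

(** Measurability of the limit is part of the conclusion: right-continuous paths and functions of
    [OU_conv] are known to be measurable only as pointwise limits. *)
Lemma bounded_convergence (mu : {measure set T -> \bar R}) D
    (f_ : nat -> T -> R) f (M : R) :
  measurable D -> (mu D < +oo)%E ->
  (forall n, measurable_fun D (f_ n)) ->
  (forall n x, D x -> `|f_ n x| <= M) ->
  (forall x, D x -> f_ n x @[n --> \oo] --> f x) ->
  bounded_measurable D f /\
  \int[mu]_(x in D) f_ n x @[n --> \oo] --> \int[mu]_(x in D) f x.
Proof.
move=> mD fD mf_ fM f_f.
have mf : measurable_fun D f by exact: measurable_fun_cvg f_f.
have bM x : D x -> `|f x| <= M.
  move=> Dx; apply: (@cvgr_to_le _ \oo _ _ _ _ _ (cvg_norm (f_f x Dx))).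
  by apply: nearW => n; exact: fM.
split; first by split => //; exists M.
have bf : bounded_measurable D f by split => //; exists M.
have [] := @dominated_convergence _ _ _ mu D mD (fun n => EFin \o f_ n)
  (EFin \o f) (cst M%:E).
- by move=> n; exact/measurable_EFinP.
- exact/measurable_EFinP.
- by apply: aeW => x Dx; apply: cvg_EFin; [exact: nearW | exact: f_f].
- exact/(bounded_measurable_integrable mD fD)/bounded_measurable_cst.
- by apply: aeW => x n Dx; rewrite lee_fin fM.
move=> _ _ h; apply: fine_cvg; rewrite fineK.
  exact: h.
by apply: integrable_fin_num => //; exact: bounded_measurable_integrable.
Qed.

End BoundedIntegrals.

Section Borel.
Context (R : realType) (d : nat).

Lemma continuous_borel_measurable (f : 'cV[R]_d -> R) : continuous f ->
  measurable_fun [set: borel_vec R d] f.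
Proof.
move=> cf; apply: (measurability _ (RGenOpens.measurableE R)) => //.
move=> _ [_ [a [b ->]] <-]; rewrite setTI; apply: sub_sigma_algebra.
by apply: open_comp => [x _|]; [exact: cf | exact: interval_open].
Qed.

Lemma random_vec_comp (dT : measure_display) (T : measurableType dT)
    (Z : T -> 'cV[R]_d) (f : 'cV[R]_d -> R) : random_vec Z -> continuous f ->
  measurable_fun setT (fun w => f (Z w)).
Proof.
by move=> mZ cf; apply: measurableT_comp mZ; exact: continuous_borel_measurable.
Qed.

End Borel.

(** * Independence of blocks of increments *)

Section Rounding.
Context (R : realType).

(* [grid_point (grid_label N y)] is [y], clamped to [[-(N+1), N+1]] and rounded
   down to a multiple of [1/(N+1)]: finitely many values, so that expectations
   become finite sums. *)
Definition grid_label (N : nat) (y : R) : 'I_(N.+1 * N.+1).*2.+1 :=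
  inord (minn (Num.truncn ((y + N.+1%:R) * N.+1%:R)) (N.+1 * N.+1).*2).

Definition grid_point (N : nat) (k : 'I_(N.+1 * N.+1).*2.+1) : R :=
  k%:R / N.+1%:R - N.+1%:R.

(** Read as a real number, the label is nondecreasing in [y], hence measurable, and a fibre is the
    preimage of a point. *)
Lemma measurable_grid_label N k : measurable [set y | grid_label N y = k].
Proof.
have mg : measurable_fun setT
    (fun y : R => (grid_label N y)%:R : R).
  apply: nondecreasing_measurable => // x y xy.
  rewrite ler_nat /grid_label !inordK ?ltnS ?geq_minr//.
  rewrite leq_min geq_minr andbT geq_min le_truncn//.
  by rewrite ler_pM2r// lerD2r.
have := mg measurableT _ (measurable_set1 (k%:R : R)).
rewrite setTI; congr measurable; apply/seteqP; split => y /=.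
  by move=> /eqP; rewrite eqr_nat => /eqP /val_inj.
by move=> ->.
Qed.

(** As soon as [|y| <= N + 1] the clamping is inactive, and rounding down costs at most
    [1 / (N + 1)], the general term of [harmonic]. *)
Lemma cvg_grid_round (y : R) :
  grid_point (grid_label N y) @[N --> \oo] --> y.
Proof.
have h : `|grid_point (grid_label N y) - y| @[N --> \oo] --> (0 : R).
  apply: (@squeeze_cvgr _ _ _ _ (cst 0) (@harmonic R)).
  - near=> N; rewrite normr_ge0/=.
    have yN : `|y| <= N.+1%:R.
      rewrite ltW//; apply: lt_le_trans (truncnS_gt _) _.
      by rewrite ler_nat ltnS; near: N; exact: nbhs_infty_ge.
    have N0 : 0 < N.+1%:R :> R by [].
    have z0 : 0 <= (y + N.+1%:R) * N.+1%:R.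
      by rewrite mulr_ge0// -lerBlDl sub0r (le_trans _ yN)// -normrN ler_norm.
    have z1 : (y + N.+1%:R) * N.+1%:R <= (N.+1 * N.+1).*2%:R.
      rewrite -addnn natrD !natrM -mulrDl ler_pM2r// lerD2r.
      by rewrite (le_trans _ yN)// ler_norm.
    rewrite /grid_point /grid_label inordK ?ltnS ?geq_minr//.
    set t := Num.truncn _.
    have tz : t%:R <= (y + N.+1%:R) * N.+1%:R by rewrite truncn_le.
    have zt : (y + N.+1%:R) * N.+1%:R < t.+1%:R by exact: truncnS_gt.
    have -> : minn t (N.+1 * N.+1).*2 = t.
      by apply/minn_idPl; rewrite -(ler_nat R); exact: le_trans tz z1.
    have -> : t%:R / N.+1%:R - N.+1%:R - y =
        (t%:R - (y + N.+1%:R) * N.+1%:R) / N.+1%:R.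
      by field; rewrite gt_eqF.
    rewrite normrM [`|N.+1%:R^-1|]gtr0_norm ?invr_gt0//.
    rewrite -[leRHS]mul1r ler_pM2r ?invr_gt0// ler_norml.
    by move: zt; rewrite -natr1 => zt; apply/andP; split; lra.
  - exact: cvg_cst.
  - exact: cvg_harmonic.
apply/cvgrPdist_le => e e0; move/cvgrPdist_le : h => /(_ _ e0).
by apply: filterS => N; rewrite sub0r normrN normr_id distrC.
Unshelve. all: by end_near. Qed.

End Rounding.

Section Decoupling.
Context (R : realType) (dT : measure_display) (T : measurableType dT)
  (P : probability T R).

(* Holds when [f] is independent of [g] and [f'] has the law of [f]. *)
Definition decoupled (g f f' : T -> R) : Prop :=
  [/\ bounded_measurable setT g, bounded_measurable setT f,
      bounded_measurable setT f' &
      \int[P]_w (g w * f w) = \int[P]_w g w * \int[P]_w f' w].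

Lemma probability_setT_lty : (P setT < +oo)%E.
Proof. by rewrite probability_setT ltry. Qed.

(** Stability under bounded pointwise limits is what makes [decoupled] usable: it is applied once to
    remove the rounding and once to pass from Riemann sums to integrals. *)
Lemma decoupled_cvg (g_ f_ f'_ : nat -> T -> R) (g f f' : T -> R) (M : R) :
  (forall n, decoupled (g_ n) (f_ n) (f'_ n)) ->
  (forall n w, `|g_ n w| <= M) -> (forall n w, `|f_ n w| <= M) ->
  (forall n w, `|f'_ n w| <= M) ->
  (forall w, g_ n w @[n --> \oo] --> g w) ->
  (forall w, f_ n w @[n --> \oo] --> f w) ->
  (forall w, f'_ n w @[n --> \oo] --> f' w) ->
  decoupled g f f'.
Proof.
move=> dec gM fM f'M cg cf cf'.
have := @bounded_convergence _ _ _ P setT _ g M measurableT probability_setT_lty.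
move=> /(_ g_) [n|n w _|w _|bg Ig]; [by have [[]] := dec n|exact: gM|exact: cg|].
have := @bounded_convergence _ _ _ P setT _ f M measurableT probability_setT_lty.
move=> /(_ f_) [n|n w _|w _|bf _]; [by have [_ []] := dec n|exact: fM|exact: cf|].
have := @bounded_convergence _ _ _ P setT _ f' M measurableT probability_setT_lty.
move=> /(_ f'_) [n|n w _|w _|bf' If'];
  [by have [_ _ []] := dec n|exact: f'M|exact: cf'|].
have := @bounded_convergence _ _ _ P setT _ (fun w => g w * f w) (M * M)
  measurableT probability_setT_lty.
move=> /(_ (fun n w => g_ n w * f_ n w)) [n|n w _|w _|_ Igf].
- by have [[mg _] [mf _] _ _] := dec n; exact: measurable_funM.
- by rewrite normrM ler_pM.
- by apply: cvgM; [exact: cg | exact: cf].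
split => //; apply: (cvg_unique _ Igf) => //.
have -> : (fun n => \int[P]_w (g_ n w * f_ n w)) =
          (fun n => \int[P]_w g_ n w * \int[P]_w f'_ n w).
  by apply/funext => n; have [] := dec n.
exact: cvgM.
Qed.

Lemma Rintegral_fin (A : finType) (a : T -> A) (phi : A -> R) :
  (forall x, measurable (a @^-1` [set x])) ->
  bounded_measurable setT (phi \o a) /\
  \int[P]_w phi (a w) = \sum_x phi x * fine (P (a @^-1` [set x])).
Proof.
move=> ma.
have phiE : phi \o a = (fun w => \sum_x phi x * \1_(a @^-1` [set x]) w).
  apply/funext => w /=; rewrite (bigD1 (a w))//= indicE mem_set// mulr1.
  rewrite big1 ?addr0// => x xa; rewrite indicE memNset ?mulr0// => /= ax.
  by move: xa; rewrite -ax eqxx.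
have b1 x : bounded_measurable setT (\1_(a @^-1` [set x]) : T -> R).
  split; first exact: measurable_indic.
  by exists 1 => w _; rewrite indicE; case: (_ \in _); rewrite ?normr1 ?normr0.
have b2 x : bounded_measurable setT
    (fun w => phi x * \1_(a @^-1` [set x]) w).
  exact: bounded_measurableM (bounded_measurable_cst _ _) (b1 x).
split; first by rewrite phiE; exact: bounded_measurable_sum.
rewrite -[LHS]/(\int[P]_w (phi \o a) w) phiE Rintegral_sum//; last first.
  exact: probability_setT_lty.
apply: eq_bigr => x _; rewrite RintegralZl//.
  by rewrite /Rintegral integral_indic// setIT.
exact: bounded_measurable_integrable probability_setT_lty (b1 x).
Qed.

(** For finitely many values both sides are finite double sums over the values of the pair [c], and
    they agree term by term. *)
Lemma decoupled_fin (A B : finType) (a : T -> A) (b b' : T -> B)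
    (phi : A -> R) (psi : B -> R) :
  (forall x, measurable (a @^-1` [set x])) ->
  (forall x, measurable (b @^-1` [set x])) ->
  (forall x, measurable (b' @^-1` [set x])) ->
  (forall x y, P (a @^-1` [set x] `&` b @^-1` [set y]) =
               (P (a @^-1` [set x]) * P (b' @^-1` [set y]))%E) ->
  decoupled (phi \o a) (psi \o b) (psi \o b').
Proof.
move=> ma mb mb' ab.
have [ba Ia] := Rintegral_fin phi ma.
have [bb Ib] := Rintegral_fin psi mb.
have [bb' Ib'] := Rintegral_fin psi mb'.
split => //; rewrite -[X in _ = X * _]/(\int[P]_w phi (a w)) Ia.
rewrite -[X in _ = _ * X]/(\int[P]_w psi (b' w)) Ib'.
pose c w := (a w, b w).
have cE x y : c @^-1` [set (x, y)] = a @^-1` [set x] `&` b @^-1` [set y].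
  apply/seteqP; split => w; rewrite /c /=; first by case.
  by case=> <- <-.
have mc x : measurable (c @^-1` [set x]).
  by case: x => x y; rewrite cE; exact: measurableI.
have [_ Ic] := Rintegral_fin (fun z => phi z.1 * psi z.2) mc.
rewrite -[LHS]/(\int[P]_w (phi (c w).1 * psi (c w).2)) Ic.
transitivity (\sum_x \sum_y phi x * psi y * fine (P (c @^-1` [set (x, y)]))).
  by rewrite pair_bigA; apply: eq_bigr => -[].
rewrite mulr_suml.
apply: eq_bigr => x _; rewrite mulr_sumr; apply: eq_bigr => y _.
by rewrite cE ab fineM ?fin_num_measure// mulrACA.
Qed.

End Decoupling.

Section Blocks.
Context (R : realType) (d : nat) (dT : measure_display) (T : measurableType dT)
  (P : probability T R).
Local Notation V := 'cV[R]_d.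

(** Sequential and coordinatewise, because it is only tested along the sequence of roundings; no
    topology on families of vectors has to be chosen. *)
Definition seq_continuous (I : Type) (F : (I -> V) -> R) : Prop :=
  forall (u : nat -> I -> V) (y : I -> V),
    (forall i k, u n i k 0 @[n --> \oo] --> y i k 0) ->
    F (u n) @[n --> \oo] --> F y.

Section labels.
Variables (I : finType) (Z : I -> T -> V) (N : nat).

(** Nested finite functions, so that the labels of a whole block form a [finType]. *)
Definition block_label (w : T) :=
  [ffun i => [ffun k => grid_label N (Z i w k 0)]].

Definition label_fiber (a : {ffun 'I_d -> 'I_(N.+1 * N.+1).*2.+1}) :
    set (borel_vec R d) :=
  [set y | forall k, grid_label N ((y : V) k 0) = a k].

Lemma measurable_label_fiber a : measurable (label_fiber a).
Proof.
have -> : label_fiber a = \bigcap_(k in [set: 'I_d])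
    ((fun y : borel_vec R d => (y : V) k 0) @^-1` [set y | grid_label N y = a k]).
  by apply/seteqP; split => [y h k _|y h k]; [exact: h | by apply: h].
apply: fin_bigcap_measurable => //.
move=> k _; rewrite -[X in measurable X]setTI.
apply: continuous_borel_measurable => //; last exact: measurable_grid_label.
exact: coord_continuous.
Qed.

Lemma block_labelE a : block_label @^-1` [set a] =
  \bigcap_(i in [set: I]) (Z i @^-1` label_fiber (a i)).
Proof.
apply/seteqP; split => w /=.
  by move=> <- i _ k /=; rewrite !ffunE.
by move=> h; apply/ffunP => i; apply/ffunP => k; rewrite !ffunE h.
Qed.

Definition block_round (a : {ffun I -> {ffun 'I_d -> 'I_(N.+1 * N.+1).*2.+1}}) :
  I -> V := fun i => \col_k grid_point R (a i k).

End labels.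

Lemma measurable_block_label (I : finType) (Z : I -> T -> V) N a :
  (forall i k, measurable_fun setT (fun w => Z i w k 0)) ->
  measurable (block_label Z N @^-1` [set a]).
Proof.
move=> mZ; rewrite block_labelE; apply: fin_bigcap_measurable => // i _.
have -> : Z i @^-1` label_fiber (a i) = \bigcap_(k in [set: 'I_d])
    ((fun w => Z i w k 0) @^-1` [set y | grid_label N y = a i k]).
  by apply/seteqP; split => [w h k _|w h k]; [exact: h | by apply: h].
apply: fin_bigcap_measurable => // k _; rewrite -[X in measurable X]setTI.
by apply: mZ => //; exact: measurable_grid_label.
Qed.

Lemma seq_continuous_round (I : finType) (Z : I -> T -> V)
    (F : (I -> V) -> R) w : seq_continuous F ->
  F (block_round (block_label Z N w)) @[N --> \oo] --> F (Z^~ w).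
Proof.
move=> cF; apply: cF => i k; under eq_fun do rewrite mxE !ffunE.
exact: cvg_grid_round.
Qed.

(** The fibres of [block_label] are rectangles, so the product rule on rectangles gives
    [decoupled_fin] for the rounded blocks; refining the rounding then gives the claim. *)
Lemma decoupled_blocks (I J : finType) (Y : I -> T -> V) (Z Z' : J -> T -> V)
    (G : (I -> V) -> R) (F : (J -> V) -> R) (M : R) :
  (forall i k, measurable_fun setT (fun w => Y i w k 0)) ->
  (forall j k, measurable_fun setT (fun w => Z j w k 0)) ->
  (forall j k, measurable_fun setT (fun w => Z' j w k 0)) ->
  (forall (A : I -> set (borel_vec R d)) (B : J -> set (borel_vec R d)),
    (forall i, measurable (A i)) -> (forall j, measurable (B j)) ->
    P ((\bigcap_(i in [set: I]) (Y i @^-1` A i)) `&`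
       (\bigcap_(j in [set: J]) (Z j @^-1` B j))) =
    (P (\bigcap_(i in [set: I]) (Y i @^-1` A i)) *
     P (\bigcap_(j in [set: J]) (Z' j @^-1` B j)))%E) ->
  seq_continuous G -> seq_continuous F ->
  (forall y, `|G y| <= M) -> (forall z, `|F z| <= M) ->
  decoupled P (fun w => G (Y^~ w)) (fun w => F (Z^~ w)) (fun w => F (Z'^~ w)).
Proof.
move=> mY mZ mZ' ind cG cF GM FM.
apply: (@decoupled_cvg _ _ _ _
  (fun N => (G \o @block_round I N) \o block_label Y N)
  (fun N => (F \o @block_round J N) \o block_label Z N)
  (fun N => (F \o @block_round J N) \o block_label Z' N) _ _ _ M) => //.
- move=> N; apply: decoupled_fin => x; try exact: measurable_block_label.
  move=> y; rewrite !block_labelE ind// => i; exact: measurable_label_fiber.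
- by move=> n w /=; exact: GM.
- by move=> n w /=; exact: FM.
- by move=> n w /=; exact: FM.
- by move=> w; exact: seq_continuous_round.
- by move=> w; exact: seq_continuous_round.
- by move=> w; exact: seq_continuous_round.
Qed.

End Blocks.
Section LevyBlocks.
Context (R : realType) (d : nat) (dT : measure_display) (T : measurableType dT)
  (P : probability T R) (L : R -> T -> 'cV[R]_d).
Hypothesis hL : levy_process P L.
Local Notation V := 'cV[R]_d.

Lemma random_vec_coord (Z : T -> V) (k : 'I_d) : random_vec Z ->
  measurable_fun setT (fun w => Z w k 0).
Proof.
by move=> mZ; apply: (random_vec_comp (f := fun y => y k 0) mZ);
  exact: coord_continuous.
Qed.

Lemma measurable_increment (s t : R) k : 0 <= s -> 0 <= t ->
  measurable_fun setT (fun w => increment L s t w k 0).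
Proof.
move=> s0 t0; under eq_fun do rewrite !mxE.
by apply: measurable_funB; apply: random_vec_coord; exact: (levy_random hL).
Qed.

Lemma levy_increment_law (s s' : R) (A : set (borel_vec R d)) :
  0 <= s <= s' -> measurable A ->
  P (increment L s s' @^-1` A) = P (L (s' - s) @^-1` A).
Proof.
move=> /andP[s0 ss'] mA.
have := levy_stationary hL s0 (_ : 0 <= s' - s) mA.
by rewrite subrKC subr_ge0 => /(_ ss').
Qed.

Section times.
Variables (m n : nat) (tau tau' : nat -> R).
Hypotheses (tau0 : 0 <= tau 0%N) (tauS : forall i, tau i <= tau i.+1).
Hypotheses (tau'0 : 0 <= tau' 0%N) (tau'S : forall i, tau' i <= tau' i.+1).
Hypothesis tau_tau' : forall j,
  tau (m + j).+1 - tau (m + j)%N = tau' j.+1 - tau' j.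

Let grid_ge0 (u : nat -> R) : 0 <= u 0%N -> (forall i, u i <= u i.+1) ->
  forall i, 0 <= u i.
Proof. by move=> u0 uS; elim=> // i IH; exact: le_trans IH (uS i). Qed.

(** All [m + n] increments are jointly independent; stationarity then moves each factor of the
    second block to the grid [tau'], which has the same steps, and independence on [tau']
    reassembles these factors. *)
Lemma levy_blocks_indep (A : 'I_m -> set (borel_vec R d))
    (B : 'I_n -> set (borel_vec R d)) :
  (forall i, measurable (A i)) -> (forall j, measurable (B j)) ->
  P ((\bigcap_(i in [set: 'I_m]) (increment L (tau i) (tau i.+1) @^-1` A i)) `&`
     (\bigcap_(j in [set: 'I_n])
        (increment L (tau (m + j)%N) (tau (m + j).+1) @^-1` B j))) =
  (P (\bigcap_(i in [set: 'I_m]) (increment L (tau i) (tau i.+1) @^-1` A i)) *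
   P (\bigcap_(j in [set: 'I_n])
        (increment L (tau' j) (tau' j.+1) @^-1` B j)))%E.
Proof.
move=> mA mB.
pose C (i : 'I_(m + n)) : set (borel_vec R d) :=
  match fintype.split i with inl i => A i | inr j => B j end.
have CL i : C (lshift n i) = A i by rewrite /C (unsplitK (inl i : 'I_m + 'I_n)).
have CR j : C (rshift m j) = B j by rewrite /C (unsplitK (inr j : 'I_m + 'I_n)).
have mC i : measurable (C i) by rewrite /C; case: fintype.split.
have -> : (\bigcap_(i in [set: 'I_m]) (increment L (tau i) (tau i.+1) @^-1` A i)) `&`
     (\bigcap_(j in [set: 'I_n])
        (increment L (tau (m + j)%N) (tau (m + j).+1) @^-1` B j)) =
   \bigcap_(i in [set: 'I_(m + n)]) (increment L (tau i) (tau i.+1) @^-1` C i).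
  apply/seteqP; split => [w [hA hB] i _|w hC].
    case: (split_ordP i) => j ->; first by rewrite CL; exact: hA.
    by rewrite CR; exact: hB.
  split => j _.
    by have := hC (lshift n j) Logic.I; rewrite CL.
  by have := hC (rshift m j) Logic.I; rewrite CR.
(* One use for the joint event, one for each factor on the right. *)
rewrite (levy_independent hL)// (levy_independent hL)// (levy_independent hL)//.
rewrite big_split_ord/=; congr (_ * _)%E.
  by apply: eq_bigr => i _; rewrite CL.
apply: eq_bigr => j _; rewrite CR.
rewrite levy_increment_law//; last by rewrite tauS (grid_ge0 tau0 tauS).
rewrite [in RHS]levy_increment_law//; last first.
  by rewrite tau'S (grid_ge0 tau'0 tau'S).
by rewrite tau_tau'.
Qed.

Lemma levy_decoupled (G : ('I_m -> V) -> R) (F : ('I_n -> V) -> R) (M : R) :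
  seq_continuous G -> seq_continuous F ->
  (forall y, `|G y| <= M) -> (forall z, `|F z| <= M) ->
  decoupled P
    (fun w => G (fun i => increment L (tau i) (tau i.+1) w))
    (fun w => F (fun j => increment L (tau (m + j)%N) (tau (m + j).+1) w))
    (fun w => F (fun j => increment L (tau' j) (tau' j.+1) w)).
Proof.
move=> cG cF GM FM.
apply: (@decoupled_blocks R d _ T P 'I_m 'I_n
  (fun i => increment L (tau i) (tau i.+1))
  (fun j => increment L (tau (m + j)%N) (tau (m + j).+1))
  (fun j => increment L (tau' j) (tau' j.+1)) G F M) => //.
- by move=> i k; apply: measurable_increment; exact: grid_ge0.
- by move=> i k; apply: measurable_increment; exact: grid_ge0.
- by move=> i k; apply: measurable_increment; exact: grid_ge0.
exact: levy_blocks_indep.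
Qed.

End times.
End LevyBlocks.

(** * Right-continuous paths and Riemann sums *)

Section Cadlag.
Context (R : realType).
Implicit Types f g : R -> R.

(** A class closed under sums and products that contains continuous kernels and coordinates of
    cadlag paths, and on which Riemann sums converge. Local boundedness is required separately, as
    right-continuity does not imply it. *)
Definition right_regular f : Prop :=
  (forall s, 0 <= s -> f u @[u --> s^'+] --> f s) /\
  (forall t, exists M : R, forall s, 0 <= s <= t -> `|f s| <= M).

Lemma right_regularD f g : right_regular f -> right_regular g ->
  right_regular (fun s => f s + g s).
Proof.
move=> [cf bf] [cg bg]; split=> [s s0|t]; first by apply: cvgD; [exact: cf | exact: cg].
have [M fM] := bf t; have [N gN] := bg t; exists (M + N) => s st.
by apply: le_trans (ler_normD _ _) _; apply: lerD; [exact: fM | exact: gN].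
Qed.

Lemma right_regularM f g : right_regular f -> right_regular g ->
  right_regular (fun s => f s * g s).
Proof.
move=> [cf bf] [cg bg]; split=> [s s0|t]; first by apply: cvgM; [exact: cf | exact: cg].
have [M fM] := bf t; have [N gN] := bg t; exists (M * N) => s st.
by rewrite normrM; apply: ler_pM => //; [exact: fM | exact: gN].
Qed.

Lemma continuous_bounded_itv f (t : R) : continuous f ->
  exists M : R, forall s, 0 <= s <= t -> `|f s| <= M.
Proof.
move=> cf; have [t0|t0] := leP 0 t; last first.
  by exists 0 => s /andP[s0 st]; move: (le_lt_trans (le_trans s0 st) t0); rewrite ltxx.
have cn : {within `[0, t], continuous (fun s => `|f s|)}.
  apply: continuous_subspaceT => s.
  exact: (continuous_comp (cf s) (@norm_continuous _ _ _)).
have [c _ cM] := EVT_max t0 cn; exists `|f c| => s st.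
by apply: cM; rewrite in_itv.
Qed.

Lemma continuous_right_regular f : continuous f -> right_regular f.
Proof.
move=> cf; split=> [s _|t]; last exact: continuous_bounded_itv.
exact: cvg_at_right_filter (cf s).
Qed.

Lemma right_regular_cst (c : R) : right_regular (cst c).
Proof. by apply: continuous_right_regular => s; exact: cvg_cst. Qed.

Lemma right_regularB f g : right_regular f -> right_regular g ->
  right_regular (fun s => f s - g s).
Proof.
move=> rf rg; under eq_fun do rewrite -mulN1r.
exact: right_regularD rf (right_regularM (right_regular_cst (-1)) rg).
Qed.

Lemma right_regular_sum (I : Type) (r : seq I) (F : I -> R -> R) :
  (forall i, right_regular (F i)) ->
  right_regular (fun s => \sum_(i <- r) F i s).
Proof.
move=> rF; elim: r => [|i r IH].
  by under eq_fun do rewrite big_nil; exact: right_regular_cst.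
by under eq_fun do rewrite big_cons; exact: right_regularD.
Qed.

Lemma right_regular_shift f (a : R) : 0 <= a -> right_regular f ->
  right_regular (fun s => f (a + s)).
Proof.
move=> a0 [cf bf]; split=> [s s0|t].
  have := cf _ (addr_ge0 a0 s0); move=> /cvgrPdist_lt h.
  apply/cvgrPdist_lt => e /h; rewrite !near_withinE !near_simpl => {}h.
  have h2 : \forall u \near s, a + s < a + u -> `|f (a + s) - f (a + u)| < e.
    have : (a + u) @[u --> s] --> a + s by apply: cvgD; [exact: cvg_cst|exact: cvg_id].
    by move=> /(_ _ h).
  by apply: filterS h2 => u + su; apply; rewrite ltrD2l.
have [M fM] := bf (a + t); exists M => s /andP[s0 st].
by apply: fM; rewrite addr_ge0//= lerD2l.
Qed.

Lemma cadlag_right_regular d (Z : R -> 'cV[R]_d) k : cadlag Z ->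
  right_regular (fun s => Z s k 0).
Proof.
move=> [rZ lZ].
have rc s : 0 <= s -> Z u k 0 @[u --> s^'+] --> Z s k 0.
  by move=> s0; exact: (@cvg_comp _ _ _ (fun u => Z u)
    (fun y : 'cV[R]_d => y k 0) _ _ _ (rZ s s0) (@coord_continuous R d 1 k 0 (Z s))).
split=> // t.
have lc s : 0 < s -> exists l : R, Z u k 0 @[u --> s^'-] --> l.
  move=> s0; have /cvg_ex[l hl] := lZ s s0; exists (l k 0).
  exact: (@cvg_comp _ _ _ (fun u => Z u) (fun y : 'cV[R]_d => y k 0) _ _ _ hl
    (@coord_continuous R d 1 k 0 l)).
(* Compactness in its near-covering form, with [M] tending to [+oo]: a bound near each point, valid
   for all large [M], yields one bound on [[0, t]]. Near [s] it combines the right limit, the left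
   limit and the value at [s]. *)
have /compact_near_coveringP/(_ R +oo (fun M s => 0 <= s -> `|Z s k 0| <= M)) :=
  @segment_compact R 0 t.
case.
- move=> s; rewrite /= in_itv/= => /andP[s0 st].
  have [M1 hM1] : exists M, \forall u \near s, s < u -> `|Z u k 0| <= M.
    exists (`|Z s k 0| + 1); have := cvgr_norm_le _ (rc s s0).
    by move=> /(_ _ (`|Z s k 0| + 1)); rewrite ltrDl ltr01 near_withinE; exact.
  have [M2 hM2] : exists M, \forall u \near s, u < s -> 0 <= u -> `|Z u k 0| <= M.
    (* At [s = 0] no left limit is available, but no point [u >= 0] lies to the left either. *)
    move: s0; rewrite le_eqVlt => /predU1P[<-|s0].
      by exists 0; near=> u => u0; rewrite leNgt u0.
    have [l hl] := lc s s0.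
    exists (`|l| + 1); have := cvgr_norm_le _ hl.
    move=> /(_ _ (`|l| + 1)); rewrite ltrDl ltr01 near_withinE => /(_ isT).
    by apply: filterS => u h us _; exact: h.
  exists ([set u | (s < u -> `|Z u k 0| <= M1) /\ (u < s -> 0 <= u -> `|Z u k 0| <= M2)],
    [set M | Num.max (Num.max M1 M2) `|Z s k 0| <= M]).
    by split; [exact: filterI | apply: nbhs_pinfty_ge; exact: num_real].
  move=> [u M]/= [[h1 h2] hM] u0.
  move: hM; rewrite !ge_max => /andP[/andP[m1 m2] m3].
  have [us|us|->//] := ltgtP u s; [exact: le_trans (h2 us u0) m2|].
  exact: le_trans (h1 us) m1.
- move=> M [_ hM]; exists (M + 1) => s st.
  have /hM : M < M + 1 by rewrite ltrDl.
  by apply; [rewrite /= in_itv|case/andP: st].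
Unshelve. all: by end_near. Qed.

End Cadlag.

Section Riemann.
Context (R : realType).
Local Notation mu := (@lebesgue_measure R).
Implicit Types f : R -> R.

Lemma lebesgue_itv_lty (b1 b2 : bool) (x y : R) :
  (mu [set` Interval (BSide b1 x) (BSide b2 y)] < +oo)%E.
Proof. by rewrite lebesgue_measure_itv/= lte_fin; case: ifP => _; rewrite ?ltry. Qed.

Definition grid (a t : R) (n k : nat) : R := a + t * (k%:R / n.+1%:R).

Lemma grid0 a t n : grid a t n 0 = a.
Proof. by rewrite /grid mul0r mulr0 addr0. Qed.

Lemma gridn a t n : grid a t n n.+1 = a + t.
Proof. by rewrite /grid divff// mulr1. Qed.

Lemma grid_step a t n k : grid a t n k.+1 - grid a t n k = t / n.+1%:R.
Proof. by rewrite /grid -natr1; field; rewrite gt_eqF. Qed.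

Lemma le_grid a t n k k' : 0 <= t -> (k <= k')%N -> grid a t n k <= grid a t n k'.
Proof.
move=> t0 kk; rewrite lerD2l ler_wpM2l// ler_pM2r ?invr_gt0//.
by rewrite ler_nat.
Qed.

(** Right endpoints are sampled: the sample point approaches [s] from above, the side on which [f]
    is continuous. *)
Definition step_fun f a t n (s : R) : R :=
  \sum_(k < n.+1) f (grid a t n k.+1) *
    \1_(`]grid a t n k, grid a t n k.+1]) s.

Lemma step_funE f a t n s : 0 <= t -> s \in `]a, a + t] ->
  exists u, [/\ step_fun f a t n s = f u, s <= u, u <= s + t / n.+1%:R & u <= a + t].
Proof.
move=> t0; rewrite in_itv/= => /andP[as_ st].
(* The cell of [s] ends at the first grid point not below [s]; its index is not 0 because
   [a < s]. *)
have exk : exists k, s <= grid a t n k by exists n.+1; rewrite gridn.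
pose k := ex_minn exk; have [] : s <= grid a t n k /\
    (forall j, s <= grid a t n j -> (k <= j)%N).
  by rewrite /k; case: ex_minnP.
case: k => [|k] sk kmin; first by move: sk; rewrite grid0 leNgt as_.
have kn : (k < n.+1)%N by apply: kmin; rewrite gridn.
have ks : grid a t n k < s.
  by rewrite ltNge; apply/negP => /kmin; rewrite ltnn.
exists (grid a t n k.+1); split => //.
- rewrite /step_fun (bigD1 (Ordinal kn))//= indicE mem_set ?mulr1; last first.
    by rewrite /= in_itv/= ks.
  rewrite big1 ?addr0// => j; rewrite -val_eqE/= => jk.
  rewrite indicE memNset ?mulr0// => /=; rewrite in_itv/= => /andP[js sj].
  have kj := kmin _ sj; move: jk; rewrite neq_ltn ltnNge -ltnS kj/= => kj'.
  by move: (lt_le_trans js sk); rewrite ltNge le_grid.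
- by rewrite -lerBlDl -(grid_step a t n k) lerD2l lerN2 ltW.
- by rewrite -(gridn a t n); exact: le_grid.
Qed.

Lemma measurable_step_fun f a t n D : measurable_fun D (step_fun f a t n).
Proof.
by apply: measurable_sum => k; apply: measurable_funM.
Qed.

Lemma Rintegral_step_fun f a t n : 0 <= t ->
  \int[mu]_(s in `]a, a + t]) step_fun f a t n s =
  \sum_(k < n.+1) f (grid a t n k.+1) * (t / n.+1%:R).
Proof.
move=> t0; rewrite Rintegral_sum//.
- apply: eq_bigr => k _; rewrite RintegralZl//; last first.
    apply: bounded_measurable_integrable => //; first exact: lebesgue_itv_lty.
    split; first exact: measurable_indic.
    by exists 1 => w _; rewrite indicE; case: (_ \in _); rewrite ?normr1 ?normr0.
  congr (_ * _); rewrite /Rintegral integral_indic//.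
  rewrite (_ : _ `&` _ = `]grid a t n k, grid a t n k.+1]%classic).
    have e := lebesgue_measure_itv `]grid a t n k, grid a t n k.+1].
    rewrite [X in fine X]e/= lte_fin; case: ltP => [_|h].
      by rewrite -EFinB/= grid_step.
    by apply/eqP; rewrite eq_le -{2}(grid_step a t n k) subr_le0 h divr_ge0.
  apply/seteqP; split => s /=; first by case.
  move=> h; split => //; move: h; rewrite !in_itv/= => /andP[h1 h2].
  apply/andP; split.
    by apply: le_lt_trans h1; rewrite -{1}(grid0 a t n); exact: le_grid.
  by apply: (le_trans h2); rewrite -(gridn a t n); exact: le_grid.
- exact: lebesgue_itv_lty.
- move=> k; apply: bounded_measurableM; first exact: bounded_measurable_cst.
  split; first exact: measurable_indic.
  by exists 1 => w _; rewrite indicE; case: (_ \in _); rewrite ?normr1 ?normr0.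
Qed.

(** The sums are integrals of step functions that are uniformly bounded and converge pointwise by
    right-continuity, so bounded convergence applies and also makes [f] measurable. *)
Lemma riemann_sum_cvg f (a t : R) : 0 <= a -> 0 <= t -> right_regular f ->
  bounded_measurable `]a, a + t] f /\
  \sum_(k < n.+1) f (grid a t n k.+1) * (t / n.+1%:R) @[n --> \oo] -->
    \int[mu]_(s in `]a, a + t]) f s.
Proof.
move=> a0 t0 [cf bf]; have [M fM] := bf (a + t).
have -> : (fun n => \sum_(k < n.+1) f (grid a t n k.+1) * (t / n.+1%:R)) =
    (fun n => \int[mu]_(s in `]a, a + t]) step_fun f a t n s).
  by apply/funext => n; rewrite Rintegral_step_fun.
apply: (@bounded_convergence _ _ _ mu _ (step_fun f a t) f M) => //.
- exact: lebesgue_itv_lty.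
- by move=> n; exact: measurable_step_fun.
- move=> n s sI; have [u [-> su _ ut]] := step_funE f n t0 sI.
  apply: fM; rewrite ut andbT; apply: le_trans su.
  by move: sI => /=; rewrite in_itv/= => /andP[/ltW/(le_trans a0)].
move=> s sI; apply/cvgrPdist_lt => e e0.
have s0 : 0 <= s.
  by move: sI => /=; rewrite in_itv/= => /andP[/ltW/(le_trans a0)].
have /cvgrPdist_lt/(_ _ e0) := cf s s0; rewrite near_withinE.
move=> /nbhs_ballP[de /= de0 hde].
near=> n.
have [u [-> su usn _]] := step_funE f n t0 sI.
(* The filter [s^'+] excludes [s] itself, so the case where [s] is a sample point is separate. *)
move: su; rewrite le_eqVlt => /predU1P[<-|su]; first by rewrite subrr normr0.
apply: hde => //=; rewrite /ball/= ltr0_norm ?subr_lt0// opprB.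
rewrite ltrBlDl; apply: (le_lt_trans usn); rewrite ltrD2l.
near: n.
have : t / n.+1%:R @[n --> \oo] --> (0 : R).
  by rewrite -(mulr0 t); apply: cvgM; [exact: cvg_cst | exact: cvg_harmonic].
by move=> /cvgr_lt/(_ _ de0).
Unshelve. all: by end_near. Qed.

Lemma right_regular_bounded_measurable f (t : R) : 0 <= t -> right_regular f ->
  bounded_measurable `[0, t] f.
Proof.
move=> t0 rf; have [[mf _] _] := riemann_sum_cvg (lexx 0) t0 rf.
split; first by apply/measurable_fun_itv_obnd_cbndP; move: mf; rewrite add0r.
by have [M fM] := rf.2 t; exists M => s /=; rewrite in_itv/=; exact: fM.
Qed.

Lemma right_regular_integrable f (t : R) : 0 <= t -> right_regular f ->
  mu.-integrable `[0, t] (EFin \o f).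
Proof.
move=> t0 rf; apply: bounded_measurable_integrable => //.
  exact: lebesgue_itv_lty.
exact: right_regular_bounded_measurable.
Qed.

Lemma Rintegral_oc_cc f (t : R) : 0 <= t -> right_regular f ->
  \int[mu]_(s in `]0, t]) f s = \int[mu]_(s in `[0, t]) f s.
Proof.
move=> t0 rf; apply: Rintegral_itv_obnd_cbnd.
apply: integrableS (right_regular_integrable t0 rf) => //.
exact: subset_itv_oc_cc.
Qed.

Lemma riemann_sum_cvg0 f (t : R) : 0 <= t -> right_regular f ->
  \sum_(k < n.+1) f (grid 0 t n k.+1) * (t / n.+1%:R) @[n --> \oo] -->
    \int[mu]_(s in `[0, t]) f s.
Proof.
move=> t0 rf; rewrite -Rintegral_oc_cc//.
by have [_] := riemann_sum_cvg (lexx 0) t0 rf; rewrite add0r.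
Qed.

(** The translation of the second integral needs no change of variables: both integrals are limits
    of the same Riemann sums, as the grid on [[s, s + t]] is the translate of the one on
    [[0, t]]. *)
Lemma Rintegral_split f (s t : R) : 0 <= s -> 0 <= t -> right_regular f ->
  \int[mu]_(u in `[0, s + t]) f u =
  \int[mu]_(u in `[0, s]) f u + \int[mu]_(u in `[0, t]) f (s + u).
Proof.
move=> s0 t0 rf; have st0 := addr_ge0 s0 t0.
have := @Rintegral_itvB R f (BLeft 0) (BRight (s + t)) s.
move=> /(_ (right_regular_integrable st0 rf)).
rewrite !bnd_simp lerDl => /(_ s0 t0) /eqP; rewrite subr_eq => /eqP ->.
rewrite [RHS]addrC; congr (_ + _); have [_ h1] := riemann_sum_cvg s0 t0 rf.
have := riemann_sum_cvg0 t0 (right_regular_shift s0 rf).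
rewrite (_ : (fun n => _) = (fun n => \sum_(k < n.+1)
    f (grid s t n k.+1) * (t / n.+1%:R))); last first.
  by apply/funext => n; apply: eq_bigr => k _; rewrite /grid add0r.
by move=> h2; exact: (cvg_unique (@Rhausdorff R) h1 h2).
Qed.

End Riemann.

(** * Integration by parts against a right-continuous function *)

Section IntegrationByParts.
Context (R : realType).
Local Notation mu := (@lebesgue_measure R).
Implicit Types a b h : R -> R.

Lemma is_derive_continuous a b : (forall s : R, is_derive s (1 : R) a (b s)) ->
  continuous a.
Proof.
by move=> da s; apply/differentiable_continuous/derivable1_diffP; case: (da s).
Qed.

Lemma integral_derive_itv a b (u t : R) : u <= t ->
  (forall s : R, is_derive s (1 : R) a (b s)) -> continuous b ->
  (\int[mu]_(s in `[u, t]) (b s)%:E = (a t - a u)%:E)%E.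
Proof.
rewrite le_eqVlt => /predU1P[->|ut] da cb.
  by rewrite set_itv1 integral_set1 subrr.
have ca := is_derive_continuous da.
rewrite (continuous_FTC2 ut _ _ (F := a))//.
- exact: continuous_subspaceT.
- split; first by move=> s _; case: (da s).
  + exact: cvg_at_right_filter (ca u).
  + exact: cvg_at_left_filter (ca t).
- by move=> s _; rewrite derive1E; case: (da s).
Qed.

Lemma EFin_Rintegral h (t : R) : 0 <= t -> right_regular h ->
  (\int[mu]_(s in `[0, t]) h s)%:E = (\int[mu]_(s in `[0%R, t]) (h s)%:E)%E.
Proof.
move=> t0 rh; rewrite /Rintegral fineK//.
by apply: integrable_fin_num => //; exact: right_regular_integrable.
Qed.

(** Both sides integrate [b s * h u] over the triangle [0 <= u <= s <= t], in the two orders allowed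
    by Fubini's theorem. The integrand is bounded and measurable on a square of finite measure,
    hence integrable. *)
Lemma integration_by_parts_right_regular a b h (t : R) : 0 <= t ->
  (forall s : R, is_derive s (1 : R) a (b s)) -> continuous b -> right_regular h ->
  \int[mu]_(s in `[0, t]) (b s * \int[mu]_(u in `[0, s]) h u) =
  a t * \int[mu]_(s in `[0, t]) h s - \int[mu]_(s in `[0, t]) (a s * h s).
Proof.
move=> t0 da cb rh.
have rb := continuous_right_regular cb.
have ra := continuous_right_regular (is_derive_continuous da).
have [mb [M bM]] := right_regular_bounded_measurable t0 rb.
have [mh [N hN]] := right_regular_bounded_measurable t0 rh.
pose D := `[0, t]%classic `*` `[0, t]%classic : set (R * R).
pose W := [set z : R * R | z.2 <= z.1].
pose g (z : R * R) : R := b z.1 * h z.2 * \1_W z.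
have mD : measurable D by exact: measurableX.
have mW : measurable W.
  have := @measurable_fun_ler _ _ _ setT (fun z : R * R => z.2) (fun z => z.1).
  move=> /(_ measurable_snd measurable_fst measurableT [set true]).
  by rewrite setTI; apply.
have mg : measurable_fun D g.
  apply: measurable_funM; last exact: measurable_indic.
  apply: measurable_funM.
    apply: (@measurable_comp _ _ _ _ _ _ `[0, t] b _ (fun z : R * R => z.1)) => //.
      by move=> _ [z [z1 z2] <-].
    exact: measurable_funTS measurable_fst.
  apply: (@measurable_comp _ _ _ _ _ _ `[0, t] h _ (fun z : R * R => z.2)) => //.
    by move=> _ [z [z1 z2] <-].
  exact: measurable_funTS measurable_snd.
have ig : (mu \x mu)%E.-integrable setT ((EFin \o g) \_ D).
  apply: (integrable_mkcond (mu := (mu \x mu)%E) (EFin \o g) mD).1.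
  apply: (@bounded_measurable_integrable _ _ _ (mu \x mu)%E D g) => //.
    rewrite [X in (X < _)%E](_ : _ = (mu `[0%R, t]%classic * mu `[0%R, t]%classic)%E).
      rewrite lebesgue_measure_itv/= lte_fin; case: ifP => _; rewrite ?mul0e//.
      by rewrite -EFinD -EFinM ltry.
    exact: product_measure1E.
  split => //; exists (M * N) => z [z1 z2]; rewrite /g normrM.
  rewrite -[leRHS]mulr1; apply: ler_pM => //.
    by rewrite normrM; apply: ler_pM => //; [exact: bM | exact: hN].
  by rewrite indicE; case: (_ \in _); rewrite ?normr1 ?normr0.
have gE s u : 0 <= u <= s -> s <= t -> ((EFin \o g) \_ D) (s, u) = (b s * h u)%:E.
  move=> /andP[u0 us] st; rewrite patchE mem_set/=; last first.
    by split; rewrite /= in_itv/= ?(le_trans u0 us)// u0 (le_trans us st).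
  by rewrite /g indicE mem_set/= ?mulr1.
have g0 s u : ~~ ((0 <= u <= s) && (s <= t)) -> ((EFin \o g) \_ D) (s, u) = 0%E.
  move=> ust; rewrite patchE; case: ifPn => //.
  rewrite inE /D/= !in_itv/= => -[/andP[s0 st] /andP[u0 ut]].
  rewrite /g indicE memNset/= ?mulr0// => us.
  by move: ust; rewrite u0 us st.
have := Fubini ig.
have -> : (\int[mu]_x \int[mu]_y ((EFin \o g) \_ D) (x, y) =
  (\int[mu]_(s in `[0%R, t]) (b s * \int[mu]_(u in `[0%R, s]) h u)%:E))%E.
  rewrite [RHS]integral_mkcond; apply: eq_integral => s _.
  rewrite patchE; case: ifPn => [|sD]; last first.
    rewrite integral0_eq// => u _; apply: g0; apply/negP => /andP[/andP[u0 us] st].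
    by move: sD; rewrite notin_setE/= in_itv/= st (le_trans u0 us).
  rewrite inE/= in_itv/= => /andP[s0 st].
  have rbh : right_regular (fun u => b s * h u).
    exact: right_regularM (right_regular_cst _) rh.
  rewrite -RintegralZl//; last exact: right_regular_integrable.
  rewrite EFin_Rintegral// [RHS]integral_mkcond; apply: eq_integral => u _.
  rewrite [RHS]patchE; case: ifPn; last first.
    rewrite notin_setE/= in_itv/= => us; apply: g0.
    by apply/negP => /andP[].
  by rewrite inE/= in_itv/= => us; exact: gE.
(* For fixed [u] the variable [s] runs over [[u, t]], where [b] integrates to [a t - a u]. *)
have -> : (\int[mu]_y \int[mu]_x ((EFin \o g) \_ D) (x, y) =
  (\int[mu]_(u in `[0%R, t]) ((a t - a u) * h u)%:E))%E.
  rewrite [RHS]integral_mkcond; apply: eq_integral => u _.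
  rewrite patchE; case: ifPn => [|uD]; last first.
    rewrite integral0_eq// => s _; apply: g0; apply/negP => /andP[/andP[u0 us] st].
    by move: uD; rewrite notin_setE/= in_itv/= u0 (le_trans us st).
  rewrite inE/= in_itv/= => /andP[u0 ut].
  rewrite EFinM -(integral_derive_itv ut da cb) -integralZr//; last first.
    apply: integrableS (right_regular_integrable t0 rb) => //.
    by apply: subset_itvr; rewrite bnd_simp.
  rewrite [RHS]integral_mkcond; apply: eq_integral => s _.
  rewrite [RHS]patchE; case: ifPn; last first.
    rewrite notin_setE/= in_itv/= => us; apply: g0.
    by apply/negP => /andP[/andP[_ us'] st']; apply: us; rewrite us'.
  by rewrite inE/= in_itv/= => /andP[us st]; rewrite -EFinM gE// u0.
move=> /(congr1 fine); rewrite -![fine _]/(Rintegral _ _ _) => ->.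
rewrite -RintegralZl//; last exact: right_regular_integrable.
rewrite -RintegralB//; last 2 first.
- by apply: right_regular_integrable => //; exact: right_regularM (right_regular_cst _) rh.
- by apply: right_regular_integrable => //; exact: right_regularM.
by apply: eq_Rintegral => u _; rewrite mulrBl.
Qed.

End IntegrationByParts.

(** * Solution of the linear equation *)

Section MatrixExponential.
Context (R : realType) (d : nat).
Implicit Types (A : 'M[R]_d) (i j : 'I_d).

Let bnd A : R := \sum_i \sum_j `|A i j|.

(** Induction works because [bnd A], the sum over all entries, dominates every row sum. *)
Lemma norm_exprmx_le A n i j : `|(A ^+ n) i j| <= bnd A ^+ n.
Proof.
have bA0 : 0 <= bnd A by apply: sumr_ge0 => k _; apply: sumr_ge0.
elim: n i j => [|n IH] i j.
  by rewrite !expr0 mxE; case: eqP => _; rewrite ?normr1 ?normr0.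
rewrite exprS [X in `|X|]mxE exprS.
apply: le_trans (ler_norm_sum _ _ _) _.
apply: (@le_trans _ _ (\sum_k `|A i k| * bnd A ^+ n)).
  by apply: ler_sum => k _; rewrite normrM ler_wpM2l.
rewrite -mulr_suml ler_wpM2r ?exprn_ge0//.
by rewrite /bnd [leRHS](bigD1 i)//= lerDl sumr_ge0// => k _; exact: sumr_ge0.
Qed.

(* Coefficients of the [m]-th derivative of [t |-> (expmx (t *: A)) i j]. *)
Definition expmx_coeff A i j (m n : nat) : R := n`!%:R^-1 * (A ^+ (n + m)) i j.

(** Domination by the exponential series at [bnd A * |t|], scaled by [bnd A ^ m]. All orders [m] are
    treated at once since termwise differentiation requires convergence of the first two derived
    series as well. *)
Lemma is_cvg_expmx_coeff A i j m (t : R) :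
  cvgn (pseries (expmx_coeff A i j m) t).
Proof.
have bA0 : 0 <= bnd A by apply: sumr_ge0 => k _; apply: sumr_ge0.
apply: normed_cvg.
have ce : cvgn (series (fun n => bnd A ^+ m * exp_coeff (bnd A * `|t|) n)).
  exact/is_cvg_seriesZ/is_cvg_series_exp_coeff.
apply: series_le_cvg ce => n /=.
- by [].
- by rewrite mulr_ge0 ?exprn_ge0// exp_coeff_ge0// mulr_ge0.
- rewrite /exp_coeff/= !normrM normrX [`|_^-1|]ger0_norm ?invr_ge0//.
  rewrite [leRHS](_ : _ = n`!%:R^-1 * bnd A ^+ (n + m) * `|t| ^+ n); last first.
    by rewrite exprMn exprD; ring.
  by rewrite ler_wpM2r ?exprn_ge0// ler_wpM2l ?invr_ge0// norm_exprmx_le.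
Qed.

Lemma pseries_diffs_expmx_coeff A i j m :
  pseries_diffs (expmx_coeff A i j m) = expmx_coeff A i j m.+1.
Proof.
apply/funext => n; rewrite /pseries_diffs /expmx_coeff factS natrM invfM.
by rewrite mulrA mulrA mulfV ?pnatr_eq0// mul1r addSnnS.
Qed.

Lemma exprmxZ A (t : R) n : (t *: A) ^+ n = t ^+ n *: A ^+ n.
Proof.
elim: n => [|n IH]; first by rewrite !expr0 scale1r.
rewrite !exprS IH -[LHS]/((t *: A) *m (t ^+ n *: A ^+ n)).
by rewrite -scalemxAl -scalemxAr scalerA.
Qed.

Lemma expmxE A i j (t : R) :
  expmx (t *: A) i j = limn (pseries (expmx_coeff A i j 0) t).
Proof.
rewrite mxE; congr (limn (series _)); apply/funext => n.
rewrite /= /expmx_coeff addn0 mxE exprmxZ mxE -mulrA; congr (_ * _).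
by rewrite mulrC.
Qed.

Lemma lim_expmx_coeff1 A i j (t : R) :
  limn (pseries (expmx_coeff A i j 1) t) =
  \sum_k expmx (t *: A) i k * A k j.
Proof.
apply/cvg_lim => //.
rewrite (_ : pseries _ t = (fun n =>
    \sum_k pseries (expmx_coeff A i k 0) t n * A k j)); last first.
  apply/funext => n; rewrite /pseries /series/=.
  under [RHS]eq_bigr do rewrite mulr_suml.
  rewrite exchange_big/=; apply: eq_bigr => p _.
  rewrite /expmx_coeff addn1 addn0 exprSr mxE mulr_sumr mulr_suml.
  by apply: eq_bigr => k _; ring.
apply: cvg_sumr => k; apply: cvgM; last exact: cvg_cst.
by rewrite expmxE; exact: is_cvg_expmx_coeff.
Qed.

Lemma is_derive_expmx A i j (t : R) :
  is_derive t (1 : R) (fun s => expmx (s *: A) i j)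
    (\sum_k expmx (t *: A) i k * A k j).
Proof.
under eq_fun do rewrite expmxE; rewrite -lim_expmx_coeff1.
rewrite -pseries_diffs_expmx_coeff; apply: (@pseries_snd_diffs _ _ (`|t| + 1)).
- exact: is_cvg_expmx_coeff.
- by rewrite pseries_diffs_expmx_coeff; exact: is_cvg_expmx_coeff.
- by rewrite !pseries_diffs_expmx_coeff; exact: is_cvg_expmx_coeff.
- by rewrite [ltRHS]ger0_norm// ltrDl.
Qed.

Lemma expmx0 : expmx (0 : 'M[R]_d) = 1%:M.
Proof.
apply/matrixP => i j; rewrite -(scale0r (0 : 'M[R]_d)) expmxE.
apply/cvg_lim => //; apply: cvg_near_cst.
near=> n; rewrite /pseries /series/=.
have n0 : (0 < n)%N by near: n; exact: nbhs_infty_gt.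
rewrite big_mkord -(prednK n0) big_ord_recl big1 => [|k _].
  by rewrite /expmx_coeff fact0 invr1 mul1r !expr0 mulr1 addr0.
by rewrite /bump/= expr0n/= mulr0.
Unshelve. all: by end_near. Qed.

End MatrixExponential.

Section OrnsteinUhlenbeck.
Context (R : realType) (d : nat) (Q : 'M[R]_d).
Local Notation mu := (@lebesgue_measure R).
Local Notation V := 'cV[R]_d.

Lemma is_derive_kernel (t s : R) i j :
  is_derive s (1 : R) (fun s => expmx (- (t - s) *: Q) i j)
    (\sum_k expmx (- (t - s) *: Q) i k * Q k j).
Proof.
have -> : (fun s => expmx (- (t - s) *: Q) i j) =
    (fun u => expmx (u *: Q) i j) \o (fun s => s - t).
  by apply/funext => u /=; rewrite opprB.
have d1 : is_derive s (1 : R) (fun s : R => s - t) 1.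
  by apply: is_derive_eq; rewrite subr0.
have d2 := is_derive_expmx Q i j (s - t).
have := @is_derive1_comp R (fun u => expmx (u *: Q) i j) (fun s => s - t) s _ _ d2 d1.
by rewrite mulr1 opprB.
Qed.

Lemma continuous_kernel (t : R) i j :
  continuous (fun s => expmx (- (t - s) *: Q) i j).
Proof. exact: (is_derive_continuous (fun s => is_derive_kernel t s i j)). Qed.

Definition right_regular_vec (Z : R -> V) : Prop :=
  forall k, right_regular (fun s => Z s k 0).

Lemma right_regular_mulmx (A : R -> 'M[R]_d) (Z : R -> V) :
  (forall i j, continuous (fun s => A s i j)) -> right_regular_vec Z ->
  right_regular_vec (fun s => A s *m Z s).
Proof.
move=> cA rZ k; under eq_fun do rewrite mxE.
apply: right_regular_sum => j; apply: right_regularM; last exact: rZ.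
exact: continuous_right_regular.
Qed.

Lemma right_regular_mulmxl (A : 'M[R]_d) (Z : R -> V) :
  right_regular_vec Z -> right_regular_vec (fun s => A *m Z s).
Proof.
by move=> rZ; apply: right_regular_mulmx => // i j s; exact: cvg_cst.
Qed.

(** With [a s = e^{-(t-s)Q}], [a' = a Q], [h = Q X] and [H] the primitive of [h], the integral of
    [a' H] over [[0, t]] is computed twice: by parts in [e1], where [a t] is the identity, and in
    [e2] after substituting [H = x + eps Y - X]. The integrals of [a h] cancel, which leaves [H t],
    hence [X t], in terms of [Y] alone. *)
Lemma OU_formula (x : V) (eps : R) (X Y : R -> V) :
  right_regular_vec X -> right_regular_vec Y ->
  (forall t, 0 <= t -> X t = x - vint t (fun s => Q *m X s) + eps *: Y t) ->
  forall t, 0 <= t -> X t = expmx (- t *: Q) *m x +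
    eps *: (Y t - vint t (fun s => expmx (- (t - s) *: Q) *m (Q *m Y s))).
Proof.
move=> rX rY eqX t t0; apply/matrixP => i j0; rewrite (ord1 j0) {j0}.
pose a s i j := expmx (- (t - s) *: Q) i j.
pose a' s i j := \sum_k a s i k * Q k j.
have ca k j : continuous (fun s => a s k j) := @continuous_kernel t k j.
have ca' k j : continuous (fun s => a' s k j).
  by move=> s; apply: cvg_sumr => l; apply: cvgM; [exact: ca | exact: cvg_cst].
pose h j s := (Q *m X s) j 0.
have rh j : right_regular (h j) by exact: right_regular_mulmxl.
pose H j s := \int[mu]_(u in `[0, s]) h j u.
have HE j s : 0 <= s -> H j s = x j 0 + eps * Y s j 0 - X s j 0.
  by move=> s0; rewrite [X in _ - X](congr1 (fun M : V => M j 0) (eqX s s0)) !mxE /H /h; ring.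
have ra k j : right_regular (fun s => a s k j) by exact: continuous_right_regular.
have ra' k j : right_regular (fun s => a' s k j) by exact: continuous_right_regular.
have at_ k j : a t k j = (k == j)%:R by rewrite /a subrr oppr0 scale0r expmx0 mxE.
have ibp j := integration_by_parts_right_regular t0
  (fun s => is_derive_kernel t s i j) (ca' i j) (rh j).
have intB j : \int[mu]_(s in `[0, t]) a' s i j = a t i j - a 0 i j.
  apply: EFin_inj; rewrite EFin_Rintegral//.
  exact: (integral_derive_itv t0 (fun s => is_derive_kernel t s i j) (ca' i j)).
have rQY := right_regular_mulmxl Q rY.
have e1 : \sum_j \int[mu]_(s in `[0, t]) (a' s i j * H j s) =
    H i t - \sum_j \int[mu]_(s in `[0, t]) (a s i j * h j s).
  under eq_bigr do rewrite ibp.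
  rewrite sumrB; congr (_ - _).
  rewrite (bigD1 i)//= -/(a t i i) at_ eqxx mul1r big1 ?addr0// => j ji.
  by rewrite -/(a t i j) at_ eq_sym (negbTE ji) mul0r.
have e2 : \sum_j \int[mu]_(s in `[0, t]) (a' s i j * H j s) =
    x i 0 - (expmx (- t *: Q) *m x) i 0
    + eps * (vint t (fun s => expmx (- (t - s) *: Q) *m (Q *m Y s))) i 0
    - \sum_j \int[mu]_(s in `[0, t]) (a s i j * h j s).
  (* The identity [a' Z = a (Q Z)]: it turns the term in [X] into [a h], already present in [e1]. *)
  have swap (Z : V) s : \sum_j a' s i j * Z j 0 = \sum_k a s i k * (Q *m Z) k 0.
    under eq_bigr do rewrite mulr_suml.
    rewrite exchange_big/=; apply: eq_bigr => k _; rewrite mxE mulr_sumr.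
    by apply: eq_bigr => j _; rewrite mulrA.
  transitivity (\sum_j \int[mu]_(s in `[0, t])
      (a' s i j * (x j 0 + eps * Y s j 0 - X s j 0))).
    apply: eq_bigr => j _; apply: eq_Rintegral => s; rewrite inE/= in_itv/=.
    by move=> /andP[s0 _]; rewrite HE.
  have fin := lebesgue_itv_lty (R := R) true false 0 t.
  have bm f : right_regular f -> bounded_measurable `[0, t] f.
    exact: right_regular_bounded_measurable.
  have int f : right_regular f -> mu.-integrable `[0, t] (EFin \o f).
    exact: right_regular_integrable.
  have rr1 j : right_regular (fun s => a' s i j * x j 0).
    exact: right_regularM (ra' i j) (right_regular_cst _).
  have rr2 : right_regular (fun s => \sum_k a s i k * (Q *m Y s) k 0).
    by apply: right_regular_sum => k; exact: right_regularM.
  have rr3 j : right_regular (fun s => a s i j * h j s).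
    exact: right_regularM.
  rewrite -Rintegral_sum//; last first.
    move=> j; apply: bm; apply: right_regularM => //; apply: right_regularB => //.
    apply: right_regularD; first exact: right_regular_cst.
    exact: right_regularM (right_regular_cst _) (rY j).
  transitivity (\int[mu]_(s in `[0, t]) (\sum_j a' s i j * x j 0 +
      eps * (\sum_k a s i k * (Q *m Y s) k 0) - \sum_k a s i k * h k s)).
    apply: eq_Rintegral => s _; rewrite -!swap mulr_sumr -big_split/= -sumrB.
    by apply: eq_bigr => j _; ring.
  rewrite RintegralB//; last 2 first.
  - apply: int; apply: right_regularD; first exact: right_regular_sum.
    exact: right_regularM (right_regular_cst _) rr2.
  - by apply: int; exact: right_regular_sum.
  rewrite RintegralD//; last 2 first.
  - by apply: int; exact: right_regular_sum.
  - by apply: int; exact: right_regularM (right_regular_cst _) rr2.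
  rewrite RintegralZl//; last exact: int.
  rewrite [X in X + _ - _]Rintegral_sum//; last first.
    by move=> j; apply: bm; exact: rr1.
  rewrite [X in _ - X]Rintegral_sum//; last first.
    by move=> j; apply: bm; exact: rr3.
  congr (_ + _ - _).
    under eq_bigr => j _.
      rewrite RintegralZr//; last exact: int.
      rewrite intB at_ mulrBl; over.
    rewrite sumrB; congr (_ - _).
      rewrite (bigD1 i)//= eqxx mul1r big1 ?addr0// => j ji.
      by rewrite eq_sym (negbTE ji) mul0r.
    by rewrite mxE; apply: eq_bigr => j _; rewrite /a subr0.
  by rewrite mxE; congr (_ * _); apply: eq_Rintegral => s _; rewrite [RHS]mxE.
have e3 : H i t = x i 0 - (expmx (- t *: Q) *m x) i 0
    + eps * (vint t (fun s => expmx (- (t - s) *: Q) *m (Q *m Y s))) i 0.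
  by move: e1; rewrite e2 => /addIr.
have := HE i t t0; rewrite e3 !mxE => e4; lra.
Qed.

End OrnsteinUhlenbeck.

(** * The stochastic convolution *)

Section CoordinatewiseConvergence.
Context (R : realType) (d : nat).
Local Notation V := 'cV[R]_d.

Definition vec_cvg (u : nat -> V) (y : V) : Prop :=
  forall k, u n k 0 @[n --> \oo] --> y k 0.

Lemma vec_cvg_cvg u y : vec_cvg u y -> u n @[n --> \oo] --> y.
Proof.
move=> h; apply/cvg_ballP => e e0.
have : \forall n \near \oo, forall k, ball (y k 0) e (u n k 0).
  apply: (@filter_forall _ _ (fun k n => ball (y k 0) e (u n k 0)) \oo) => k.
  by move/cvg_ballP : (h k); exact.
by apply: filterS => n hn; split => // i j; rewrite (ord1 j).
Qed.

Lemma vec_cvg_comp (f : V -> R) u y : continuous f -> vec_cvg u y ->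
  f (u n) @[n --> \oo] --> f y.
Proof.
by move=> cf uy; exact: (@cvg_comp _ _ _ u f _ _ _ (vec_cvg_cvg uy) (cf y)).
Qed.

Lemma vec_cvg_cst y : vec_cvg (fun=> y) y.
Proof. by move=> k; exact: cvg_cst. Qed.

Lemma vec_cvgD u u' y y' : vec_cvg u y -> vec_cvg u' y' ->
  vec_cvg (fun n => u n + u' n) (y + y').
Proof.
by move=> h h' k; rewrite mxE; under eq_fun do rewrite mxE; exact: cvgD.
Qed.

Lemma vec_cvg_mulmx (A : 'M[R]_d) u y : vec_cvg u y ->
  vec_cvg (fun n => A *m u n) (A *m y).
Proof.
move=> h k; rewrite mxE; under eq_fun do rewrite mxE.
by apply: cvg_sumr => j; apply: cvgM; [exact: cvg_cst | exact: h].
Qed.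

Lemma vec_cvgZ (a : R) u y : vec_cvg u y ->
  vec_cvg (fun n => a *: u n) (a *: y).
Proof.
move=> h k; rewrite mxE; under eq_fun do rewrite mxE.
by apply: cvgM; [exact: cvg_cst | exact: h].
Qed.

Lemma vec_cvgB u u' y y' : vec_cvg u y -> vec_cvg u' y' ->
  vec_cvg (fun n => u n - u' n) (y - y').
Proof.
move=> h h'; have := vec_cvgD h (vec_cvgZ (a := -1) h').
by rewrite scaleN1r; under eq_fun do rewrite scaleN1r.
Qed.

Lemma vec_cvg_sum (I : Type) (r : seq I) (P : pred I) (u : nat -> I -> V) y :
  (forall i, vec_cvg (u^~ i) (y i)) ->
  vec_cvg (fun n => \sum_(i <- r | P i) u n i) (\sum_(i <- r | P i) y i).
Proof.
move=> h; elim: r => [|i r IH].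
  by rewrite big_nil; under eq_fun do rewrite big_nil; exact: vec_cvg_cst.
rewrite big_cons; under eq_fun do rewrite big_cons.
by case: ifP => // _; apply: vec_cvgD => //; exact: h.
Qed.

Lemma seq_continuous_comp (I : Type) (f : V -> R) (Phi : (I -> V) -> V) :
  continuous f ->
  (forall (u : nat -> I -> V) y, (forall i, vec_cvg (u^~ i) (y i)) ->
    vec_cvg (fun n => Phi (u n)) (Phi y)) ->
  seq_continuous (fun z => f (Phi z)).
Proof. by move=> cf cPhi u y uy; exact: (vec_cvg_comp cf (cPhi u y uy)). Qed.

Lemma riemann_sum_vec (t : R) (Z : R -> V) : 0 <= t -> right_regular_vec Z ->
  vec_cvg (fun n => \sum_(k < n.+1) (t / n.+1%:R) *: Z (grid 0 t n k.+1))
    (vint t Z).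
Proof.
move=> t0 rZ i; rewrite mxE (_ : (fun n => _) = (fun n =>
    \sum_(k < n.+1) Z (grid 0 t n k.+1) i 0 * (t / n.+1%:R))); last first.
  by apply/funext => n; rewrite summxE; apply: eq_bigr => k _; rewrite mxE mulrC.
exact: (riemann_sum_cvg0 t0 (rZ i)).
Qed.

End CoordinatewiseConvergence.

Section Convolution.
Context (R : realType) (d : nat) (dT : measure_display) (T : measurableType dT)
  (P : probability T R) (L : R -> T -> 'cV[R]_d) (Q : 'M[R]_d).
Hypothesis hL : levy_process P L.
Local Notation V := 'cV[R]_d.

Let E (t : R) : 'M[R]_d := expmx (- t *: Q).

(** The summand U of the decomposition of O_{s+t}: the convolution driven by the path restarted at
    time [s]. [OU_past] is the summand V. *)
Definition OU_shift (s t : R) (w : T) : V :=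
  OU_conv Q (fun u w => L (s + u) w - L s w) t w.

Definition OU_past (s t : R) (w : T) : V :=
  OU_conv Q L (s + t) w - OU_shift s t w.

Definition psum (n : nat) (z : 'I_n.+1 -> V) (k : nat) : V :=
  \sum_(i < n.+1 | (i < k)%N) z i.

(** Riemann sum of [OU_conv] as a function of [n + 1] increments. The kernel always uses the grid on
    [[0, t]], so one functional serves both for increments over [[s, s + t]], giving [OU_shift], and
    over [[0, t]], giving [OU_conv]. *)
Definition OU_sum (t : R) (n : nat) (z : 'I_n.+1 -> V) : V :=
  psum z n.+1 - \sum_(k < n.+1) (t / n.+1%:R) *:
    (E (t - grid 0 t n k.+1) *m (Q *m psum z k.+1)).

(** Discretizes the formula of [OU_pastE]: [psum z n.+1] stands for [L s], and the last sum is the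
    integral over [[0, t]] of the kernel applied to this frozen value. *)
Definition OU_past_sum (s t : R) (n : nat) (z : 'I_n.+1 -> V) : V :=
  psum z n.+1
  - \sum_(k < n.+1) (s / n.+1%:R) *:
      (E (s + t - grid 0 s n k.+1) *m (Q *m psum z k.+1))
  - \sum_(k < n.+1) (t / n.+1%:R) *:
      (E (t - grid 0 t n k.+1) *m (Q *m psum z n.+1)).

Lemma vec_cvg_psum n (u : nat -> 'I_n.+1 -> V) y k :
  (forall i, vec_cvg (u^~ i) (y i)) ->
  vec_cvg (fun N => psum (u N) k) (psum y k).
Proof. by move=> h; apply: vec_cvg_sum. Qed.

Lemma seq_continuous_OU_sum (f : V -> R) t n : continuous f ->
  seq_continuous (fun z => f (@OU_sum t n z)).
Proof.
move=> cf; apply: seq_continuous_comp => // u y uy.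
apply: vec_cvgB; first exact: vec_cvg_psum.
by apply: vec_cvg_sum => k; apply: vec_cvgZ; do 2 apply: vec_cvg_mulmx;
  exact: vec_cvg_psum.
Qed.

Lemma seq_continuous_OU_past_sum (f : V -> R) s t n : continuous f ->
  seq_continuous (fun z => f (@OU_past_sum s t n z)).
Proof.
move=> cf; apply: seq_continuous_comp => // u y uy.
apply: vec_cvgB; first apply: vec_cvgB; first exact: vec_cvg_psum.
  by apply: vec_cvg_sum => k; apply: vec_cvgZ; do 2 apply: vec_cvg_mulmx;
    exact: vec_cvg_psum.
by apply: vec_cvg_sum => k; apply: vec_cvgZ; do 2 apply: vec_cvg_mulmx;
  exact: vec_cvg_psum.
Qed.

Lemma psum_increment (a t : R) n (k : nat) w : (k <= n.+1)%N ->
  psum (fun j : 'I_n.+1 => increment L (grid a t n j) (grid a t n j.+1) w) k =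
  L (grid a t n k) w - L a w.
Proof.
move=> kn; rewrite /psum -(big_ord_widen _ (fun j =>
  increment L (grid a t n j) (grid a t n j.+1) w))//.
rewrite -(big_mkord xpredT (fun j => increment L (grid a t n j) (grid a t n j.+1) w)).
by rewrite telescope_sumr// grid0.
Qed.

Lemma right_regular_levy w : right_regular_vec (fun u => L u w).
Proof. by move=> k; apply: cadlag_right_regular; exact: (levy_cadlag hL). Qed.

Lemma right_regular_vec_shift (s : R) w : 0 <= s ->
  right_regular_vec (fun u => L (s + u) w).
Proof.
move=> s0 k; exact: (right_regular_shift s0 (right_regular_levy w k)).
Qed.

Lemma right_regular_vecB (Y Z : R -> V) : right_regular_vec Y ->
  right_regular_vec Z -> right_regular_vec (fun u => Y u - Z u).
Proof.
move=> rY rZ k; under eq_fun do rewrite !mxE.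
exact: right_regularB (rY k) (rZ k).
Qed.

Lemma right_regular_kernel (t : R) (Z : R -> V) : right_regular_vec Z ->
  right_regular_vec (fun u => E (t - u) *m (Q *m Z u)).
Proof.
move=> rZ; apply: right_regular_mulmx; first exact: continuous_kernel.
exact: right_regular_mulmxl.
Qed.

Lemma OU_sum_shift (s t : R) w : 0 <= s -> 0 <= t ->
  vec_cvg (fun n => OU_sum t (fun j : 'I_n.+1 =>
    increment L (grid s t n j) (grid s t n j.+1) w)) (OU_shift s t w).
Proof.
move=> s0 t0.
rewrite (_ : (fun n => _) = (fun n => (L (s + t) w - L s w) -
   \sum_(k < n.+1) (t / n.+1%:R) *: (E (t - grid 0 t n k.+1) *m
     (Q *m (L (s + grid 0 t n k.+1) w - L s w))))); last first.
  apply/funext => n; rewrite /OU_sum psum_increment// gridn; congr (_ - _).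
  apply: eq_bigr => k _; rewrite psum_increment//.
  by have -> : grid s t n k.+1 = s + grid 0 t n k.+1 by rewrite /grid add0r.
apply: vec_cvgB; first exact: vec_cvg_cst.
apply: (@riemann_sum_vec _ _ t (fun u => E (t - u) *m (Q *m (L (s + u) w - L s w)))) => //.
apply: right_regular_kernel; apply: right_regular_vecB.
  exact: right_regular_vec_shift.
by move=> k; exact: right_regular_cst.
Qed.

Lemma OU_conv_shift0 t w : OU_shift 0 t w = OU_conv Q L t w.
Proof.
rewrite /OU_shift /OU_conv (levy_start hL) add0r subr0; congr (_ - vint _ _).
by apply/funext => u; rewrite add0r subr0.
Qed.

Lemma vintB (t : R) (Y Z : R -> V) : 0 <= t -> right_regular_vec Y ->
  right_regular_vec Z -> vint t (fun u => Y u - Z u) = vint t Y - vint t Z.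
Proof.
move=> t0 rY rZ; apply/matrixP => i j; rewrite !mxE -RintegralB//.
- by apply: eq_Rintegral => u _; rewrite !mxE.
- exact: right_regular_integrable t0 (rY i).
- exact: right_regular_integrable t0 (rZ i).
Qed.

Lemma vint_split (s t : R) (Z : R -> V) : 0 <= s -> 0 <= t ->
  right_regular_vec Z ->
  vint (s + t) Z = vint s Z + vint t (fun u => Z (s + u)).
Proof.
by move=> s0 t0 rZ; apply/matrixP => i j; rewrite !mxE Rintegral_split.
Qed.

(* [OU_past s t] is a functional of the path of [L] on [[0, s]]. *)
Lemma OU_pastE (s t : R) w : 0 <= s -> 0 <= t ->
  OU_past s t w = L s w - vint s (fun u => E (s + t - u) *m (Q *m L u w))
    - vint t (fun u => E (t - u) *m (Q *m L s w)).
Proof.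
move=> s0 t0; rewrite /OU_past /OU_shift /OU_conv.
rewrite vint_split//; last exact/right_regular_kernel/right_regular_levy.
have -> : (fun u => expmx (- (s + t - (s + u)) *: Q) *m (Q *m L (s + u) w)) =
    (fun u => E (t - u) *m (Q *m L (s + u) w)).
  by apply/funext => u; rewrite /E; congr (expmx (- _ *: Q) *m _); ring.
have -> : (fun u => expmx (- (t - u) *: Q) *m (Q *m (L (s + u) w - L s w))) =
    (fun u => E (t - u) *m (Q *m L (s + u) w) - E (t - u) *m (Q *m L s w)).
  by apply/funext => u; rewrite !mulmxBr.
rewrite vintB//.
- by rewrite /E; set a := vint _ _; set b := vint _ _; set c := vint _ _;
    rewrite !opprB; apply/matrixP => i j; rewrite !mxE; ring.
- exact/right_regular_kernel/right_regular_vec_shift.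
- by apply: right_regular_kernel => k; exact: right_regular_cst.
Qed.

Lemma OU_past_sum_cvg (s t : R) w : 0 <= s -> 0 <= t ->
  vec_cvg (fun n => OU_past_sum s t (fun j : 'I_n.+1 =>
    increment L (grid 0 s n j) (grid 0 s n j.+1) w)) (OU_past s t w).
Proof.
move=> s0 t0; rewrite OU_pastE//.
rewrite (_ : (fun n => _) = (fun n => L s w -
   \sum_(k < n.+1) (s / n.+1%:R) *: (E (s + t - grid 0 s n k.+1) *m
     (Q *m L (grid 0 s n k.+1) w)) -
   \sum_(k < n.+1) (t / n.+1%:R) *: (E (t - grid 0 t n k.+1) *m
     (Q *m L s w)))); last first.
  apply/funext => n; rewrite /OU_past_sum psum_increment// gridn add0r.
  rewrite (levy_start hL) subr0; congr (_ - _ - _).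
  by apply: eq_bigr => k _; rewrite psum_increment// (levy_start hL) subr0.
apply: vec_cvgB; first apply: vec_cvgB; first exact: vec_cvg_cst.
  apply: (@riemann_sum_vec _ _ s (fun u => E (s + t - u) *m (Q *m (L u w)))) => //.
  exact/right_regular_kernel/right_regular_levy.
apply: (@riemann_sum_vec _ _ t (fun u => E (t - u) *m (Q *m (L s w)))) => //.
by apply: right_regular_kernel => k; exact: right_regular_cst.
Qed.

(** On Riemann sums this is the decoupling of two consecutive blocks of [n + 1] increments; the mesh
    then tends to 0 along every path. *)
Lemma decoupled_OU (s t : R) (f g : V -> R) (M : R) : 0 <= s -> 0 <= t ->
  continuous f -> continuous g ->
  (forall y, `|f y| <= M) -> (forall y, `|g y| <= M) ->
  decoupled P (fun w => g (OU_past s t w)) (fun w => f (OU_shift s t w))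
    (fun w => f (OU_conv Q L t w)).
Proof.
move=> s0 t0 cf cg fM gM.
apply: (@decoupled_cvg _ _ _ _
  (fun n w => g (OU_past_sum s t (fun j : 'I_n.+1 =>
    increment L (grid 0 s n j) (grid 0 s n j.+1) w)))
  (fun n w => f (OU_sum t (fun j : 'I_n.+1 =>
    increment L (grid s t n j) (grid s t n j.+1) w)))
  (fun n w => f (OU_sum t (fun j : 'I_n.+1 =>
    increment L (grid 0 t n j) (grid 0 t n j.+1) w))) _ _ _ M) => //.
- move=> n.
  (* Glues the grids of [[0, s]] and [[s, s + t]]: the minimum freezes the first term at [s], and
     truncated subtraction keeps the second at 0 up to index [n + 1]. *)
  pose tau (i : nat) : R := grid 0 s n (minn i n.+1) + grid 0 t n (i - n.+1).
  have tauL (i : nat) : (i <= n.+1)%N -> tau i = grid 0 s n i.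
    by move=> hi; rewrite /tau (minn_idPl hi) (eqP hi) grid0 addr0.
  have tauR j : tau (n.+1 + j)%N = grid s t n j.
    rewrite /tau (minn_idPr _) ?leq_addr// addKn gridn add0r.
    by rewrite /grid add0r.
  have eL w : (fun j : 'I_n.+1 => increment L (grid 0 s n j) (grid 0 s n j.+1) w) =
      (fun j : 'I_n.+1 => increment L (tau j) (tau j.+1) w).
    by apply/funext => j; rewrite !tauL// ltnW.
  have eR w : (fun j : 'I_n.+1 => increment L (grid s t n j) (grid s t n j.+1) w) =
      (fun j : 'I_n.+1 => increment L (tau (n.+1 + j)%N) (tau (n.+1 + j).+1) w).
    by apply/funext => j; rewrite -addnS !tauR.
  rewrite (_ : (fun w => g _) = (fun w => g (OU_past_sum s t (fun j : 'I_n.+1 =>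
    increment L (tau j) (tau j.+1) w)))); last by apply/funext => w; rewrite eL.
  rewrite (_ : (fun w => f (OU_sum t (fun j : 'I_n.+1 =>
      increment L (grid s t n j) (grid s t n j.+1) w))) =
    (fun w => f (OU_sum t (fun j : 'I_n.+1 =>
      increment L (tau (n.+1 + j)%N) (tau (n.+1 + j).+1) w))));
    last by apply/funext => w; rewrite eR.
  apply: (@levy_decoupled _ _ _ _ _ _ hL n.+1 n.+1 tau (grid 0 t n) _ _ _ _ _
    (fun z => g (OU_past_sum s t z)) (fun z => f (OU_sum t z)) M) => //.
  + by rewrite tauL// grid0.
  + move=> i; apply: lerD; apply: le_grid => //.
      by rewrite leq_min geq_minr andbT geq_min leqnSn.
    by apply: leq_sub2r.
  + by rewrite grid0.
  + by move=> i; exact: le_grid.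
  + by move=> j; rewrite -addnS !tauR !grid_step.
  + exact: seq_continuous_OU_past_sum.
  + exact: seq_continuous_OU_sum.
- by move=> w; apply: vec_cvg_comp => //; exact: OU_past_sum_cvg.
- by move=> w; apply: vec_cvg_comp => //; exact: OU_sum_shift.
- move=> w; apply: vec_cvg_comp => //.
  by rewrite -OU_conv_shift0; exact: OU_sum_shift.
Qed.

End Convolution.

(** * Weak limits and moments *)

Section EuclideanNorm.
Context (R : realType).

(** The sum of the squares of [b f - c g] equals [b (a b - c^2)]; if [b = 0], every [g i]
    vanishes. *)
Lemma cauchy_schwarz_sum (I : finType) (f g : I -> R) :
  (\sum_i f i * g i) ^+ 2 <= (\sum_i f i ^+ 2) * (\sum_i g i ^+ 2).
Proof.
set a := \sum_i f i ^+ 2; set b := \sum_i g i ^+ 2; set c := \sum_i f i * g i.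
have b0 : 0 <= b by apply: sumr_ge0 => i _; exact: sqr_ge0.
have : 0 <= \sum_i (b * f i - c * g i) ^+ 2.
  by apply: sumr_ge0 => i _; exact: sqr_ge0.
have -> : \sum_i (b * f i - c * g i) ^+ 2 = b * (a * b - c ^+ 2).
  transitivity (\sum_i (b ^+ 2 * f i ^+ 2 - 2 * b * c * (f i * g i) + c ^+ 2 * g i ^+ 2)).
    by apply: eq_bigr => i _; ring.
  by rewrite big_split/= sumrB -!mulr_sumr -/a -/b -/c; ring.
move: b0; rewrite le_eqVlt => /predU1P[b0 _|b0]; last by rewrite pmulr_rge0// subr_ge0.
have g0 i : g i = 0.
  apply/eqP; rewrite -sqrf_eq0; apply/eqP.
  by apply: (psumr_eq0P (P := xpredT) (F := fun i => g i ^+ 2)) => // j _; exact: sqr_ge0.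
by rewrite -b0 mulr0 /c big1 ?expr0n// => i _; rewrite g0 mulr0.
Qed.

(** Any finite index type is allowed, since the complex norm uses it on pairs of a coordinate and a
    choice of real or imaginary part. *)
Lemma sqrt_sum_triangle (I : finType) (f g : I -> R) :
  Num.sqrt (\sum_i (f i + g i) ^+ 2) <=
  Num.sqrt (\sum_i f i ^+ 2) + Num.sqrt (\sum_i g i ^+ 2).
Proof.
have a0 : 0 <= \sum_i f i ^+ 2 by apply: sumr_ge0 => i _; exact: sqr_ge0.
have b0 : 0 <= \sum_i g i ^+ 2 by apply: sumr_ge0 => i _; exact: sqr_ge0.
rewrite -(@ger0_norm _ (_ + _)) ?addr_ge0// -sqrtr_sqr ler_wsqrtr//.
rewrite sqrrD !sqr_sqrtr// -sqrtrM//.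
have -> : \sum_i (f i + g i) ^+ 2 =
    \sum_i f i ^+ 2 + (\sum_i f i * g i) *+ 2 + \sum_i g i ^+ 2.
  by rewrite -sumrMnl -!big_split/=; apply: eq_bigr => i _; rewrite sqrrD.
rewrite lerD2r lerD2l lerMn2r/=; apply: le_trans (ler_norm _) _.
by rewrite -sqrtr_sqr ler_wsqrtr// cauchy_schwarz_sum.
Qed.

Context (d : nat).
Local Notation V := 'cV[R]_d.

Lemma enorm_ge0 (x : V) : 0 <= enorm x.
Proof. exact: sqrtr_ge0. Qed.

Lemma enormD (x y : V) : enorm (x + y) <= enorm x + enorm y.
Proof.
rewrite /enorm; under eq_bigr do rewrite mxE.
exact: (sqrt_sum_triangle (fun i => x i 0) (fun i => y i 0)).
Qed.

Lemma enormZ (a : R) (x : V) : enorm (a *: x) = `|a| * enorm x.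
Proof.
rewrite /enorm; under eq_bigr do rewrite mxE exprMn.
by rewrite -mulr_sumr sqrtrM ?sqr_ge0// sqrtr_sqr.
Qed.

Lemma enormN (x : V) : enorm (- x) = enorm x.
Proof. by rewrite -scaleN1r enormZ normrN1 mul1r. Qed.

Lemma enormB_ge (x y : V) : enorm x - enorm y <= enorm (x + y).
Proof.
by rewrite lerBlDr -(enormN y); apply: le_trans (enormD _ _); rewrite addrK.
Qed.

Lemma enorm_continuous : continuous (@enorm R d).
Proof.
move=> x; apply: (@cvg_comp _ _ _ (fun y : V => \sum_(i < d) y i 0 ^+ 2)
  Num.sqrt); last exact: sqrt_continuous.
apply: (@cvg_sumr _ _ _ (nbhs x) (nbhs_filter x) _
  (fun i (y : V) => y i 0 ^+ 2) (fun i => x i 0 ^+ 2)) => i.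
by under eq_fun do rewrite expr2; apply: cvgM; exact: coord_continuous.
Qed.

Lemma continuous_comp_enorm (f : R -> R) : continuous f ->
  continuous (fun y : V => f (enorm y)).
Proof. by move=> cf y; exact: (continuous_comp (@enorm_continuous y) (cf _)). Qed.

End EuclideanNorm.

Section PositivePower.
Context (R : realType) (p : R) (p0 : 0 < p).

(* [a `^ p] is [1] for negative [a], hence the truncation. *)
Definition ppow (x : R) : R := Num.max x 0 `^ p.

Lemma ppowE (x : R) : 0 <= x -> ppow x = x `^ p.
Proof. by move=> x0; rewrite /ppow (max_idPl x0). Qed.

Lemma ppow_ge0 x : 0 <= ppow x.
Proof. exact: powR_ge0. Qed.

Lemma le_ppow : {homo ppow : x y / x <= y}.
Proof.
move=> x y xy; apply: ge0_ler_powR; first exact: ltW.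
- by rewrite nnegrE le_max lexx orbT.
- by rewrite nnegrE le_max lexx orbT.
- by rewrite ge_max !le_max xy lexx orbT.
Qed.

Lemma ppow0 x : x <= 0 -> ppow x = 0.
Proof. by move=> x0; rewrite /ppow (max_idPr x0) powR0// gt_eqF. Qed.

Lemma ppow_continuous : continuous ppow.
Proof.
move=> x; have [x0|x0|->] := ltgtP x 0.
- apply: (@near_cst_continuous _ _ 0); near=> y; rewrite ppow0// ltW//.
  by near: y; exact: lt_nbhsl.
- have : {for x, continuous (fun a : R => a `^ p)}.
    apply/differentiable_continuous/derivable1_diffP/derivable_powR.
    by rewrite in_itv/= x0.
  move=> h; rewrite /continuous_at ppowE ?ltW//; apply: cvg_trans h.
  apply: near_eq_cvg; near=> y; rewrite ppowE// ltW//.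
  by near: y; exact: lt_nbhsr.
- apply/cvgrPdist_le => e e0; rewrite ppow0//.
  (* The [p]-th root of [e]: below it, negative [y] included, [ppow] is at most [e]. *)
  have d0 : 0 < e `^ p^-1 by exact: powR_gt0.
  near=> y; rewrite sub0r normrN ger0_norm ?ppow_ge0//.
  have ey : y <= e `^ p^-1.
    rewrite ltW//; near: y; exact: lt_nbhsl.
  apply: le_trans (le_ppow ey) _; rewrite ppowE ?(ltW d0)//.
  by rewrite -powRrM mulVf ?gt_eqF// powRr1// ltW.
Unshelve. all: by end_near. Qed.

Lemma ppowM x y : 0 <= x -> 0 <= y -> ppow (x * y) = ppow x * ppow y.
Proof. by move=> x0 y0; rewrite !ppowE ?mulr_ge0// powRM. Qed.

(** From [x + y <= 2 max(x, y)]; unlike a convexity bound, this covers [p < 1] as well. *)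
Lemma ppowD_le x y : 0 <= x -> 0 <= y ->
  ppow (x + y) <= ppow 2 * ppow x + ppow 2 * ppow y.
Proof.
move=> x0 y0; rewrite -!ppowM//; have [xy|/ltW yx] := leP x y.
  by apply: (@le_trans _ _ (ppow (2 * y))); rewrite ?lerDr ?ppow_ge0//; apply: le_ppow; lra.
by apply: (@le_trans _ _ (ppow (2 * x))); rewrite ?lerDl ?ppow_ge0//; apply: le_ppow; lra.
Qed.

End PositivePower.

Section ContinuousMinMax.
Context (R : realType) (U : topologicalType).
Implicit Types f g : U -> R.

Lemma continuous_minr f g : continuous f -> continuous g ->
  continuous (fun x => Num.min (f x) (g x)).
Proof. by move=> cf cg x; exact: (continuous_min (cf x) (cg x)). Qed.

Lemma continuous_maxr f g : continuous f -> continuous g ->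
  continuous (fun x => Num.max (f x) (g x)).
Proof. by move=> cf cg x; exact: (continuous_max (cf x) (cg x)). Qed.

End ContinuousMinMax.

(** * Tightness and comparison of the tails of O_t with those of the limit *)

Section WeakLimits.
Context (R : realType) (d : nat) (dT : measure_display) (T : measurableType dT)
  (P : probability T R) (L : R -> T -> 'cV[R]_d) (Q : 'M[R]_d)
  (dT' : measure_display) (T' : measurableType dT') (P' : probability T' R)
  (Oinf : T' -> 'cV[R]_d).
Hypotheses (hL : levy_process P L) (hOinf : random_vec Oinf)
  (hO : cvg_in_distribution P P' (OU_conv Q L) Oinf).
Local Notation V := 'cV[R]_d.
Local Notation O := (OU_conv Q L).

(** Measurability is extracted from [decoupled_OU] with [s = 0], whose third function is
    [f (O t)]. *)
Lemma bounded_measurable_OU (f : V -> R) (M t : R) : 0 <= t ->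
  continuous f -> (forall y, `|f y| <= M) ->
  bounded_measurable setT (fun w => f (O t w)).
Proof.
move=> t0 cf fM.
by have [_ _] := decoupled_OU Q hL (lexx 0) t0 cf cf fM fM.
Qed.

Lemma measurable_OU (f : V -> R) (t : R) : 0 <= t -> continuous f ->
  (forall y, 0 <= f y) -> measurable_fun setT (fun w => f (O t w)).
Proof.
move=> t0 cf f0.
apply: (@measurable_fun_cvg _ _ _ _ (fun n w => Num.min (f (O t w)) n%:R)).
  move=> n; have cm : continuous (fun y => Num.min (f y) n%:R).
    by apply: continuous_minr => //; exact: cst_continuous.
  have hm y : `|Num.min (f y) n%:R| <= n%:R.
    by rewrite ger0_norm ?le_min ?f0//= ge_min lexx orbT.
  by have [] := bounded_measurable_OU t0 cm hm.
move=> w _; apply: cvg_near_cst.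
by apply: filterS (near_ge_nat (f (O t w))) => n; move/min_idPl.
Qed.

Lemma bounded_measurable_Oinf (f : V -> R) (M : R) :
  continuous f -> (forall y, `|f y| <= M) ->
  bounded_measurable setT (fun w => f (Oinf w)).
Proof.
by move=> cf fM; split; [exact: random_vec_comp | exists M => w _; exact: fM].
Qed.

Lemma Rintegral_OU_cvg (f : V -> R) (M : R) :
  continuous f -> (forall y, `|f y| <= M) ->
  \int[P]_w f (O t w) @[t --> +oo] --> \int[P']_w f (Oinf w).
Proof.
move=> cf fM; have := hO cf (ex_intro _ M fM); rewrite !unlock => h.
apply: fine_cvg; rewrite fineK; first exact: h.
apply: integrable_fin_num => //; apply: bounded_measurable_integrable => //.
  exact: probability_setT_lty.
exact: (bounded_measurable_Oinf cf fM).
Qed.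

Lemma EFin_Rintegral_prob (d0 : measure_display) (T0 : measurableType d0)
    (P0 : probability T0 R) (f : T0 -> R) : bounded_measurable setT f ->
  ((\int[P0]_w f w)%:E = \int[P0]_w (f w)%:E)%E.
Proof.
move=> bf; rewrite /Rintegral fineK//; apply: integrable_fin_num => //.
by apply: bounded_measurable_integrable => //; exact: probability_setT_lty.
Qed.

Lemma Rintegral_prob_cst (d0 : measure_display) (T0 : measurableType d0)
    (P0 : probability T0 R) (c : R) : \int[P0]_w cst c w = c.
Proof.
have -> : \int[P0]_w cst c w = c * fine (P0 setT) by exact: Rintegral_cst.
by rewrite probability_setT mulr1.
Qed.

Lemma RintegralD_subr1 (d0 : measure_display) (T0 : measurableType d0)
    (P0 : probability T0 R) (f g : T0 -> R) :
  bounded_measurable setT f -> bounded_measurable setT g ->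
  \int[P0]_w (f w + g w - 1) = \int[P0]_w f w + \int[P0]_w g w - 1.
Proof.
have int h := @bounded_measurable_integrable _ _ _ P0 setT h measurableT
  (probability_setT_lty P0).
move=> bf bg.
rewrite RintegralB//; [|exact/int/bounded_measurableD|exact/int/bounded_measurable_cst].
rewrite RintegralD//; [|exact: int|exact: int].
by rewrite Rintegral_prob_cst.
Qed.

Lemma le_Rintegral_prob (d0 : measure_display) (T0 : measurableType d0)
    (P0 : probability T0 R) (f g : T0 -> R) :
  bounded_measurable setT f -> bounded_measurable setT g ->
  (forall w, f w <= g w) -> \int[P0]_w f w <= \int[P0]_w g w.
Proof.
move=> bf bg fg; apply: le_Rintegral => //;
  by apply: bounded_measurable_integrable => //; exact: probability_setT_lty.
Qed.

(** Monotone convergence for the limit variable produces an [n] with expectation above [c], and weak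
    convergence transfers this [n] to large [t]. [G] may be infinite: it is used for the constant 1,
    for the power of the norm and for [+oo]. *)
Lemma OU_lower_bound (g : nat -> V -> R) (G : V -> \bar R) (c : R) :
  (forall n, continuous (g n)) -> (forall n y, 0 <= g n y) ->
  (forall n, exists M, forall y, `|g n y| <= M) ->
  (forall y, nondecreasing_seq (g ^~ y)) ->
  (forall y, (g n y)%:E @[n --> \oo] --> G y) ->
  (c%:E < \int[P']_w G (Oinf w))%E ->
  exists n, \forall t \near +oo, c < \int[P]_w g n (O t w).
Proof.
move=> cg g0 gM gnd gG cG.
have mono : (\int[P']_w (g n (Oinf w))%:E)%E @[n --> \oo] -->
    (\int[P']_w G (Oinf w))%E.
  have -> : (\int[P']_w G (Oinf w))%E =
      (\int[P']_w limn (fun n => (g n (Oinf w))%:E))%E.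
    by apply: eq_integral => w _; rewrite (cvg_lim _ (gG (Oinf w))).
  apply: (@cvg_monotone_convergence _ _ _ P' setT measurableT
    (fun n w => (g n (Oinf w))%:E)).
  - by move=> n; apply/measurable_EFinP; exact: random_vec_comp.
  - by move=> n w _; rewrite lee_fin.
  - by move=> w _ m n mn; rewrite lee_fin; exact: gnd.
have [n cn] : exists n, (c%:E < \int[P']_w (g n (Oinf w))%:E)%E.
  apply: contrapT => /forallNP h; move: cG; rewrite ltNge => /negP; apply.
  apply: (cvge_to_le mono); apply: nearW => n.
  by rewrite leNgt; apply/negP; exact: h.
exists n; have [M hM] := gM n.
have bm := bounded_measurable_Oinf (cg n) hM.
rewrite -EFin_Rintegral_prob// lte_fin in cn.
exact: (cvgr_gt _ (Rintegral_OU_cvg (cg n) hM)).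
Qed.

(** A continuous substitute for the indicator of the ball of radius [K]; the unit ramp explains the
    extra terms in [2 * K + 2] and [2 * K + 3]. *)
Definition cutoff (K : R) (y : V) : R := Num.max 0 (Num.min 1 (K + 1 - enorm y)).

Lemma cutoff_continuous K : continuous (cutoff K).
Proof.
apply: (@continuous_comp_enorm _ _ (fun x => Num.max 0 (Num.min 1 (K + 1 - x)))).
apply: continuous_maxr; first exact: cst_continuous.
apply: continuous_minr; first exact: cst_continuous.
by move=> u; apply: cvgB; [exact: cvg_cst | exact: cvg_id].
Qed.

Lemma cutoff_ge0 K y : 0 <= cutoff K y.
Proof. by rewrite /cutoff le_max lexx. Qed.

Lemma cutoff_le1 K y : cutoff K y <= 1.
Proof. by rewrite /cutoff ge_max ler01 ge_min lexx. Qed.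

Lemma cutoff_norm K y : `|cutoff K y| <= 1.
Proof. by rewrite ger0_norm ?cutoff_ge0// cutoff_le1. Qed.

Lemma cutoff1 K y : enorm y <= K -> cutoff K y = 1.
Proof.
move=> yK; rewrite /cutoff (min_idPl _); last by lra.
by apply/max_idPr.
Qed.

Lemma cutoff0 K y : K + 1 <= enorm y -> cutoff K y = 0.
Proof.
by move=> yK; apply/max_idPl; rewrite ge_min; apply/orP; right; lra.
Qed.

Lemma le_cutoff K K' y : K <= K' -> cutoff K y <= cutoff K' y.
Proof.
move=> KK; have [yK|Ky] := leP (enorm y) K'.
  by rewrite (cutoff1 yK) cutoff_le1.
have [yK|yK] := leP (K + 1) (enorm y); first by rewrite cutoff0// cutoff_ge0.
rewrite /cutoff ge_max !le_max lexx/= le_min !ge_min lexx/=.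
by apply/orP; right; apply/orP; right; lra.
Qed.

(** The level 3/4 is such that two of these bounds leave [3/4 + 3/4 - 1 = 1/2] for the past. *)
Lemma OU_tight : exists2 K : R, 0 <= K &
  \forall t \near +oo, 3 / 4 < \int[P]_w cutoff K (O t w).
Proof.
have [||||||n hn] := @OU_lower_bound (fun n => cutoff n%:R) (fun=> 1%E) (3 / 4).
- by move=> n; exact: cutoff_continuous.
- by move=> n; exact: cutoff_ge0.
- by move=> n; exists 1; exact: cutoff_norm.
- by move=> y m n mn; apply: le_cutoff; rewrite ler_nat.
- move=> y; apply: cvg_near_cst.
  by apply: filterS (near_ge_nat (enorm y)) => n /cutoff1 ->.
- by rewrite integral_cst//= probability_setT mule1 lte_fin; lra.
by exists n%:R.
Qed.

Let half_le (a b : R) : 3 / 4 < a -> 3 / 4 < b -> 2^-1 <= a + b - 1.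
Proof. lra. Qed.

Let le_double (a b c : R) : 2^-1 <= a -> 0 <= b -> a * b <= c -> b <= 2 * c.
Proof. by move=> a2 b0 abc; have /le_trans/(_ abc) := ler_wpM2r b0 a2; lra. Qed.

(** A smoothed union bound: if [v + u] and [u] both have norm below [K + 1], then [v] has norm below
    [2 * K + 2]. *)
Lemma cutoffD K (v u : V) :
  cutoff K (v + u) + cutoff K u - 1 <= cutoff (2 * K + 2) v.
Proof.
have vu1 := cutoff_le1 K (v + u); have u1 := cutoff_le1 K u.
have v0 := cutoff_ge0 (2 * K + 2) v.
have [vK|Kv] := leP (enorm v) (2 * K + 2); first by rewrite (cutoff1 vK); lra.
have [uK|Ku] := leP (K + 1) (enorm u); first by rewrite (cutoff0 uK); lra.
rewrite (@cutoff0 K (v + u)); first by lra.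
by have := enormB_ge v u; lra.
Qed.

(** Where the cutoff does not vanish, [v] has norm below [2 * K + 3], so adding [v] lowers the norm
    of [u] by at most that much. *)
Lemma cutoff_mul K (h : R -> R) (v u : V) : {homo h : x y / x <= y} ->
  (forall x, 0 <= h x) ->
  cutoff (2 * K + 2) v * h (enorm u - (2 * K + 3)) <= h (enorm (v + u)).
Proof.
move=> hnd h0; have [vK|Kv] := leP (2 * K + 2 + 1) (enorm v).
  by rewrite (cutoff0 vK) mul0r.
apply: (@le_trans _ _ (h (enorm u - (2 * K + 3)))).
  by rewrite ler_piMl// cutoff_le1.
by apply: hnd; have := enormB_ge u v; rewrite (addrC u v); lra.
Qed.

(** Here [A] is O_{s+t}, [B] is O_t, [U] the restarted part and [W] the past. With C = 2K + 3 the
    chain is E h(|B| - C) / 2 <= E cutoff(W) E h(|B| - C) = E [cutoff(W) h(|U| - C)] <= E h(|A|). *)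
Lemma tail_step (A B U W : T -> V) (K : R) (h : R -> R) :
  (forall w, A w = W w + U w) ->
  {homo h : x y / x <= y} -> (forall x, 0 <= h x) ->
  bounded_measurable setT (fun w => cutoff K (A w)) ->
  bounded_measurable setT (fun w => h (enorm (A w))) ->
  decoupled P (cst (1 : R)) (fun w => cutoff K (U w)) (fun w => cutoff K (B w)) ->
  decoupled P (fun w => cutoff (2 * K + 2) (W w))
    (fun w => h (enorm (U w) - (2 * K + 3))) (fun w => h (enorm (B w) - (2 * K + 3))) ->
  3 / 4 < \int[P]_w cutoff K (A w) -> 3 / 4 < \int[P]_w cutoff K (B w) ->
  \int[P]_w h (enorm (B w) - (2 * K + 3)) <= 2 * \int[P]_w h (enorm (A w)).
Proof.
move=> AE hnd h0 bA bhA [_ bU _ EU] [bW bhU bhB E2].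
(* Decoupling from the constant 1 says that [U] and [B] give the same expectation to [cutoff K]. *)
have {}EU : \int[P]_w cutoff K (U w) = \int[P]_w cutoff K (B w).
  rewrite -[RHS]mul1r -[X in X * _](Rintegral_prob_cst P (1 : R)) -EU.
  by apply: eq_Rintegral => w _; rewrite mul1r.
have bAU := bounded_measurableB (bounded_measurableD bA bU)
  (bounded_measurable_cst setT (1 : R)).
move=> hA hB.
have half : 2^-1 <= \int[P]_w cutoff (2 * K + 2) (W w).
  apply: (@le_trans _ _ (\int[P]_w (cutoff K (A w) + cutoff K (U w) - 1))).
    by rewrite RintegralD_subr1// EU; exact: half_le.
  by apply: le_Rintegral_prob => // w; rewrite AE; exact: cutoffD.
have fB0 : 0 <= \int[P]_w h (enorm (B w) - (2 * K + 3)) by exact: Rintegral_ge0.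
have : \int[P]_w (cutoff (2 * K + 2) (W w) * h (enorm (U w) - (2 * K + 3))) <=
    \int[P]_w h (enorm (A w)).
  apply: le_Rintegral_prob => //; first exact: bounded_measurableM.
  by move=> w; rewrite AE; exact: cutoff_mul.
by rewrite E2; exact: le_double.
Qed.

(* [OU_past] is the difference of two tight families, so it is bounded with
   probability at least [1/2]; by independence the tail of [O t] is then
   dominated by that of [O (s + t)]. *)
Lemma OU_tail_step (K s t : R) (h : R -> R) (M : R) : 0 <= s -> 0 <= t ->
  continuous h -> {homo h : x y / x <= y} -> (forall x, 0 <= h x <= M) ->
  3 / 4 < \int[P]_w cutoff K (O (s + t) w) ->
  3 / 4 < \int[P]_w cutoff K (O t w) ->
  \int[P]_w h (enorm (O t w) - (2 * K + 3)) <=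
    2 * \int[P]_w h (enorm (O (s + t) w)).
Proof.
move=> s_ge0 t_ge0 ch hnd hM.
set C := 2 * K + 3.
have h0 x : 0 <= h x by case/andP: (hM x).
have hn x : `|h x| <= M by case/andP: (hM x) => _ h1; rewrite ger0_norm.
have ch1 : continuous (fun y : V => h (enorm y)) by exact: continuous_comp_enorm.
have ch2 : continuous (fun y : V => h (enorm y - C)).
  apply: (@continuous_comp_enorm _ _ (fun x => h (x - C))) => x.
  have c1 : continuous (fun x : R => x - C).
    by move=> u; apply: cvgB; [exact: cvg_id | exact: cvg_cst].
  exact: (continuous_comp (c1 x) (ch _)).
have M0 : 0 <= M by case/andP: (hM 0) => h2 h1; exact: le_trans h1.
have cK := @cutoff_continuous K; have cK2 := @cutoff_continuous (2 * K + 2).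
have M1 : M <= M + 1 by rewrite lerDl ler01.
have M2 : 1 <= M + 1 by rewrite lerDr.
have f_le (y : V) : `|h (enorm y - C)| <= M + 1 by exact: le_trans (hn _) M1.
have g_le (y : V) : `|cutoff (2 * K + 2) y| <= M + 1.
  exact: le_trans (cutoff_norm _ _) M2.
have n1 (y : V) : `|cst 1 y : R| <= 1 by rewrite normr1.
have D1 := decoupled_OU Q hL s_ge0 t_ge0 cK
  (@cst_continuous _ _ (1 : R)) (@cutoff_norm K) n1.
have D2 := decoupled_OU Q hL s_ge0 t_ge0 ch2 cK2 f_le g_le.
have st_ge0 := addr_ge0 s_ge0 t_ge0.
have bO := bounded_measurable_OU st_ge0 cK (@cutoff_norm K).
have bhO := bounded_measurable_OU st_ge0 ch1 (fun y => hn (enorm y)).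
have OE w : O (s + t) w = OU_past L Q s t w + OU_shift L Q s t w.
  by rewrite /OU_past subrK.
exact: (tail_step OE hnd h0 bO bhO D1 D2).
Qed.

(** [C] and [t0] are chosen before [h] and [M], so the bound survives the removal of a truncation of
    [h]. *)
Lemma OU_tail_domination : exists C t0 : R, [/\ 0 <= C, 0 <= t0 &
  forall (t : R) (h : R -> R) (M : R), t0 <= t -> continuous h ->
    {homo h : x y / x <= y} -> (forall x, 0 <= h x <= M) ->
    \int[P]_w h (enorm (O t w) - C) <= 2 * \int[P']_w h (enorm (Oinf w))].
Proof.
have [K K0 [t1 [_ ht1]]] := OU_tight.
(* Beyond [t0], the time [t] and all later times [s + t] satisfy the tightness bound. *)
pose t0 := Num.max 0 t1 + 1.
have t0_ge0 : 0 <= t0 by rewrite addr_ge0// le_max lexx.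
have t01 t : t0 <= t -> t1 < t.
  by apply: lt_le_trans; rewrite /t0 ltr_pwDr// le_max lexx orbT.
exists (2 * K + 3), t0; split => //; first by rewrite addr_ge0// mulr_ge0.
move=> t h M tt ch hnd hM.
have t_ge0 : 0 <= t by exact: le_trans tt.
have hn x : `|h x| <= M by case/andP: (hM x) => h0 h1; rewrite ger0_norm.
have ch1 : continuous (fun y : V => h (enorm y)) by exact: continuous_comp_enorm.
have lim : (2 * \int[P]_w h (enorm (O (s + t) w))) @[s --> +oo] -->
    2 * \int[P']_w h (enorm (Oinf w)).
  apply: cvgM; first exact: cvg_cst.
  have l1 := Rintegral_OU_cvg ch1 (fun y => hn (enorm y)).
  apply: (@cvg_comp _ _ _ (fun s => s + t) (fun u => \int[P]_w h (enorm (O u w))) _ _ _ _ l1).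
  move=> A [u [_ uA]]; exists (u - t); split; first exact: num_real.
  by move=> v vu /=; apply: uA; rewrite -ltrBlDr.
apply: (cvgr_to_ge lim); near=> s.
have ss : t0 <= s by near: s; apply: nbhs_pinfty_ge; exact: num_real.
have s_ge0 : 0 <= s by exact: le_trans ss.
apply: (OU_tail_step s_ge0 t_ge0 ch hnd hM).
  by apply: ht1; apply: t01; rewrite (le_trans ss)// lerDl.
by apply: ht1; exact: t01.
Unshelve. all: by end_near. Qed.

End WeakLimits.

(** * Lower bounds for moments, uniform in the shift *)

Section Moments.
Context (R : realType) (d : nat) (dT : measure_display) (T : measurableType dT)
  (P : probability T R) (L : R -> T -> 'cV[R]_d) (Q : 'M[R]_d)
  (dT' : measure_display) (T' : measurableType dT') (P' : probability T' R)
  (Oinf : T' -> 'cV[R]_d).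
Hypotheses (hL : levy_process P L) (hOinf : random_vec Oinf)
  (hO : cvg_in_distribution P P' (OU_conv Q L) Oinf).
Local Notation V := 'cV[R]_d.
Local Notation O := (OU_conv Q L).
Context (p : R) (p0 : 0 < p).
Local Notation pw := (ppow p).

Lemma continuous_ppow_enorm_shift (a : V) (c : R) :
  continuous (fun y : V => pw (enorm (a + y) + c)).
Proof.
move=> y.
have c1 : continuous (fun x : R => pw (x + c)).
  move=> x; have c2 : continuous (fun x : R => x + c).
    by move=> u; apply: cvgD; [exact: cvg_id | exact: cvg_cst].
  exact: (continuous_comp (c2 x) (@ppow_continuous _ _ p0 _)).
have c3 : continuous (fun y : V => a + y).
  by move=> u; apply: (@cvgD _ _ _ (nbhs u) _ (cst a) id); [exact: cvg_cst | exact: cvg_id].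
exact: (continuous_comp (c3 y) (@continuous_comp_enorm _ _ _ c1 _)).
Qed.

Lemma measurable_moment (a : V) (c t : R) : 0 <= t ->
  measurable_fun setT (fun w => pw (enorm (a + O t w) + c)).
Proof.
move=> t0; apply: (measurable_OU Q hL t0 (f := fun y => pw (enorm (a + y) + c))).
  exact: continuous_ppow_enorm_shift.
by move=> y; exact: ppow_ge0.
Qed.

Lemma measurable_moment0 (a : V) (t : R) : 0 <= t ->
  measurable_fun setT (fun w => pw (enorm (a + O t w))).
Proof.
by move=> t0; have := measurable_moment a 0 t0; under eq_fun do rewrite addr0.
Qed.

Lemma moment_ge (g : V -> R) (M t c : R) (a : V) : 0 <= t -> continuous g ->
  (forall y, 0 <= g y) -> (forall y, `|g y| <= M) ->
  (forall y, g y <= pw (enorm (a + y))) -> c < \int[P]_w g (O t w) ->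
  (c%:E <= \int[P]_w (pw (enorm (a + O t w)))%:E)%E.
Proof.
move=> t0 cg g0 gM ga; rewrite -lte_fin EFin_Rintegral_prob; last first.
  exact: (bounded_measurable_OU Q hL t0 cg gM).
move=> /ltW/le_trans; apply; apply: ge0_le_integral => //.
- by move=> w _; rewrite lee_fin.
- by apply/measurable_EFinP; exact: (measurable_OU Q hL t0 cg g0).
- by apply/measurable_EFinP; exact: measurable_moment0.
- by move=> w _; rewrite lee_fin.
Qed.

(** The truncations [g n] increase to the power of the norm, and [g n] stays below the power of the
    norm of [a + y] for every [a] of norm at most [1 / (n + 1)]. This radius is the required
    [eta]. *)
Lemma moment_lower (c : R) :
  (c%:E < \int[P']_w (pw (enorm (Oinf w)))%:E)%E ->
  exists2 eta : R, 0 < eta & \forall t \near +oo, forall a : V,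
    enorm a <= eta -> (c%:E <= \int[P]_w (pw (enorm (a + O t w)))%:E)%E.
Proof.
move=> cE.
pose g n (y : V) := Num.min (pw (enorm y - n.+1%:R^-1)) n%:R.
have cg n : continuous (g n).
  apply: continuous_minr; last exact: cst_continuous.
  by have := @continuous_ppow_enorm_shift 0 (- n.+1%:R^-1); under eq_fun do rewrite add0r.
have g0 n y : 0 <= g n y by rewrite /g le_min ppow_ge0/=.
have gM n y : `|g n y| <= n%:R by rewrite ger0_norm// /g ge_min lexx orbT.
have [||||||n hn] := OU_lower_bound hOinf hO (g := g)
  (G := fun y => (pw (enorm y))%:E) (c := c) => //.
- by move=> n; exists n%:R; exact: gM.
- move=> y m n mn; rewrite /g le_min !ge_min ler_nat mn orbT andbT.
  apply/orP; left; apply: le_ppow => //.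
  by rewrite lerD2l lerN2 lef_pV2 ?posrE// ler_nat ltnS.
- move=> y; apply: cvg_EFin; first exact: nearW.
  have h : pw (enorm y - n.+1%:R^-1) @[n --> \oo] --> pw (enorm y).
    apply: (@cvg_comp _ _ _ (fun n => enorm y - n.+1%:R^-1) pw _ _ _ _
      (@ppow_continuous _ _ p0 _)).
    have : (enorm y - n.+1%:R^-1) @[n --> \oo] --> enorm y - 0.
      by apply: cvgB; [exact: cvg_cst | exact: cvg_harmonic].
    by rewrite subr0.
  apply: cvg_trans h; apply: near_eq_cvg.
  apply: filterS (near_ge_nat (pw (enorm y))) => n hn.
  apply/esym/min_idPl; apply: le_trans hn; apply: le_ppow => //.
  by rewrite gerBl.
exists n.+1%:R^-1 => //; near=> t => a an.
apply: (@moment_ge (g n) n%:R) => //; last by near: t.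
move=> y; rewrite /g ge_min; apply/orP; left; apply: le_ppow => //.
have ya := enormB_ge y a; rewrite (addrC a y).
by apply: le_trans ya; rewrite lerD2l lerN2.
Unshelve. all: by end_near. Qed.

(** If [a] has norm at least [n], then [a + y] has norm at least [n - |y|]; the powers of these
    bounds are bounded and increase to [+oo], so some [n] serves as [A]. *)
Lemma moment_large (c : R) :
  exists A : R, \forall t \near +oo, forall a : V,
    A <= enorm a -> (c%:E <= \int[P]_w (pw (enorm (a + O t w)))%:E)%E.
Proof.
pose g n (y : V) := pw (n%:R - enorm y).
have cg n : continuous (g n).
  apply: (@continuous_comp_enorm _ _ (fun x => pw (n%:R - x))) => x.
  have c2 : continuous (fun x : R => n%:R - x).
    by move=> u; apply: cvgB; [exact: cvg_cst | exact: cvg_id].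
  exact: (continuous_comp (c2 x) (@ppow_continuous _ _ p0 _)).
have g0 n y : 0 <= g n y by exact: ppow_ge0.
have gM n y : `|g n y| <= pw n%:R.
  by rewrite ger0_norm//; apply: le_ppow => //; rewrite gerBl enorm_ge0.
have [||||||n hn] := OU_lower_bound hOinf hO (g := g) (G := fun=> +oo%E) (c := c) => //.
- by move=> n; exists (pw n%:R); exact: gM.
- by move=> y m n mn; apply: le_ppow => //; rewrite lerD2r ler_nat.
- move=> y; apply/cvgeyPge => B.
  pose B' := Num.max B 0 `^ p^-1.
  have : \forall n \near \oo, B' + enorm y <= n%:R by exact: near_ge_nat.
  apply: filterS => n hn; rewrite lee_fin.
  apply: (@le_trans _ _ (pw B')); last by apply: le_ppow => //; lra.
  rewrite ppowE ?powR_ge0// -powRrM mulVf ?gt_eqF// powRr1 ?le_max ?lexx//.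
  by rewrite orbT.
- by rewrite integral_cst//= probability_setT mule1 ltry.
exists n%:R; near=> t => a an.
apply: (@moment_ge (g n) (pw n%:R)) => //; last by near: t.
by move=> y; apply: le_ppow => //; have := enormB_ge a y; lra.
Unshelve. all: by end_near. Qed.

End Moments.

Lemma dominated_Rintegral_cvg (R : realType) (d0 : measure_display)
    (T0 : measurableType d0) (mu : {measure set T0 -> \bar R})
    (f_ : nat -> T0 -> R) (f G : T0 -> R) :
  (forall n, measurable_fun setT (f_ n)) ->
  mu.-integrable setT (EFin \o G) ->
  (forall n w, `|f_ n w| <= G w) ->
  (forall w, f_ n w @[n --> \oo] --> f w) ->
  \int[mu]_w f_ n w @[n --> \oo] --> \int[mu]_w f w.
Proof.
move=> mf_ iG fG fc.
have mf : measurable_fun setT f.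
  by apply: (@measurable_fun_cvg _ _ _ _ f_) => // w _; exact: fc.
have [] := @dominated_convergence _ _ _ mu setT measurableT (fun n => EFin \o f_ n)
  (EFin \o f) (EFin \o G).
- by move=> n; exact/measurable_EFinP.
- exact/measurable_EFinP.
- by apply: aeW => w _; apply: cvg_EFin; [exact: nearW | exact: fc].
- exact: iG.
- by apply: aeW => w n _; rewrite lee_fin.
by move=> iF _ h; apply: fine_cvg; rewrite fineK; [exact: h | exact: integrable_fin_num].
Qed.

(** * Uniform integrability and upper bounds for moments *)

Section MomentUpper.
Context (R : realType) (d : nat) (dT : measure_display) (T : measurableType dT)
  (P : probability T R) (L : R -> T -> 'cV[R]_d) (Q : 'M[R]_d)
  (dT' : measure_display) (T' : measurableType dT') (P' : probability T' R)
  (Oinf : T' -> 'cV[R]_d).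
Hypotheses (hL : levy_process P L) (hOinf : random_vec Oinf)
  (hO : cvg_in_distribution P P' (OU_conv Q L) Oinf).
Local Notation V := 'cV[R]_d.
Local Notation O := (OU_conv Q L).
Context (p : R) (p0 : 0 < p).
Local Notation pw := (ppow p).

Lemma continuous_ppow_enorm (c : R) : continuous (fun y : V => pw (enorm y + c)).
Proof.
have := @continuous_ppow_enorm_shift R d p p0 0 c.
by under eq_fun do rewrite add0r.
Qed.

Lemma measurable_ppow_Oinf (c : R) :
  measurable_fun setT (fun w => pw (enorm (Oinf w) + c)).
Proof.
apply: (@random_vec_comp R d _ _ Oinf (fun y => pw (enorm y + c)) hOinf).
exact: continuous_ppow_enorm.
Qed.

Hypothesis Efin : (\int[P']_w (pw (enorm (Oinf w)))%:E < +oo)%E.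

Lemma integrable_ppow_Oinf (c : R) : 0 <= c ->
  P'.-integrable setT (EFin \o (fun w => pw (enorm (Oinf w) + c))).
Proof.
move=> c0.
have m0 : measurable_fun setT (fun w => pw (enorm (Oinf w))).
  by have := measurable_ppow_Oinf 0; under eq_fun do rewrite addr0.
have i1 : P'.-integrable setT (EFin \o (fun w => pw (enorm (Oinf w)))).
  apply/integrableP; split; first exact/measurable_EFinP.
  apply: le_lt_trans Efin; apply: ge0_le_integral => //.
  - by apply: measurableT_comp => //; exact/measurable_EFinP.
  - exact/measurable_EFinP.
  - by move=> w _ /=; rewrite ger0_norm// ppow_ge0.
have i2 : P'.-integrable setT (EFin \o
    (fun w => pw 2 * pw (enorm (Oinf w)) + pw 2 * pw c)).
  have -> : EFin \o (fun w => pw 2 * pw (enorm (Oinf w)) + pw 2 * pw c) =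
     (fun w => (pw 2)%:E * (pw (enorm (Oinf w)))%:E + (pw 2 * pw c)%:E)%E.
    by apply/funext => w /=; rewrite EFinD EFinM.
  apply: integrableD => //; first exact: integrableZl.
  exact: (bounded_measurable_integrable measurableT (probability_setT_lty P')
    (bounded_measurable_cst setT (pw 2 * pw c))).
apply: le_integrable i2 => //; first exact/measurable_EFinP/measurable_ppow_Oinf.
move=> w _ /=; rewrite lee_fin !ger0_norm ?ppow_ge0//; last first.
  by rewrite addr_ge0// mulr_ge0// ppow_ge0.
by apply: ppowD_le => //; exact: enorm_ge0.
Qed.

Lemma Oinf_tail (C e : R) : 0 <= C -> 0 < e ->
  exists n : nat, \int[P']_w Num.max (pw (enorm (Oinf w) + C) - n%:R) 0 < e.
Proof.
move=> C0 e0.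
have h : \int[P']_w Num.max (pw (enorm (Oinf w) + C) - n%:R) 0 @[n --> \oo] -->
    \int[P']_w cst 0 w.
  apply: (@dominated_Rintegral_cvg _ _ _ P' _ _ (fun w => pw (enorm (Oinf w) + C))).
  - move=> n; apply: measurable_maxr => //; apply: measurable_funB => //.
    exact: measurable_ppow_Oinf.
  - exact: integrable_ppow_Oinf.
  - move=> n w; rewrite ger0_norm ?le_max ?lexx ?orbT//.
    by rewrite ge_max ppow_ge0 andbT gerBl.
  - move=> w; apply: cvg_near_cst.
    apply: filterS (near_ge_nat (pw (enorm (Oinf w) + C))) => n hn.
    by apply/max_idPr; rewrite subr_le0.
rewrite Rintegral_prob_cst in h.
by have [n _ hn] := cvgr_lt _ h _ e0; exists n; exact: (hn n (leqnn n)).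
Qed.

Lemma Oinf_shift (c : R) : \int[P']_w pw (enorm (Oinf w)) < c ->
  exists n : nat, \int[P']_w pw (enorm (Oinf w) + n.+1%:R^-1) < c.
Proof.
move=> Ec.
have h : \int[P']_w pw (enorm (Oinf w) + n.+1%:R^-1) @[n --> \oo] -->
    \int[P']_w pw (enorm (Oinf w)).
  apply: (@dominated_Rintegral_cvg _ _ _ P' _ _ (fun w => pw (enorm (Oinf w) + 1))).
  - by move=> n; exact: measurable_ppow_Oinf.
  - exact: integrable_ppow_Oinf.
  - move=> n w; rewrite ger0_norm ?ppow_ge0//; apply: le_ppow => //.
    by rewrite lerD2l invf_le1// ler1n.
  - move=> w; apply: (@cvg_comp _ _ _ (fun n => enorm (Oinf w) + n.+1%:R^-1) pw
      _ _ _ _ (@ppow_continuous _ _ p0 _)).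
    have : (enorm (Oinf w) + n.+1%:R^-1) @[n --> \oo] --> enorm (Oinf w) + 0.
      by apply: cvgD; [exact: cvg_cst | exact: cvg_harmonic].
    by rewrite addr0.
by have [n _ hn] := cvgr_lt _ h _ Ec; exists n; exact: (hn n (leqnn n)).
Qed.

Lemma continuous_ppow_truncated (c m K : R) :
  continuous (fun x : R => Num.min (Num.max (pw (x + c) - m) 0) K).
Proof.
apply: continuous_minr; last exact: cst_continuous.
apply: continuous_maxr; last exact: cst_continuous.
move=> x; apply: cvgB; last exact: cvg_cst.
have c2 : continuous (fun x : R => x + c).
  by move=> u; apply: cvgD; [exact: cvg_id | exact: cvg_cst].
exact: (continuous_comp (c2 x) (@ppow_continuous _ _ p0 _)).
Qed.

(** The excess over [m] is truncated at [n], bounded through [OU_tail_domination], and recovered by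
    monotone convergence in [n]. The [+ 1] inside the power leaves room for shifts [a] of norm at
    most 1. *)
Lemma OU_uniformly_integrable (e : R) : 0 < e ->
  exists (m : nat) (t0 : R), 0 <= t0 /\ forall t, t0 <= t ->
    (\int[P]_w (Num.max (pw (enorm (O t w) + 1) - m%:R) 0)%:E <= e%:E)%E.
Proof.
move=> e0.
have [C [t0 [C0 t00 dom]]] := OU_tail_domination hL hOinf hO.
have C1 : 0 <= C + 1 by rewrite addr_ge0.
have e2 : 0 < e / 2 by rewrite divr_gt0.
(* [e / 2] offsets the factor 2 of the domination, and [C + 1] its shift by [C]. *)
have [m hm] := Oinf_tail C1 e2.
exists m, t0; split => // t tt.
have t_ge0 : 0 <= t by exact: le_trans tt.
have mX (n : nat) : measurable_fun setT
    (fun w => Num.min (Num.max (pw (enorm (O t w) + 1) - m%:R) 0) n%:R).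
  apply: measurable_minr => //; apply: measurable_maxr => //.
  apply: measurable_funB => //.
  apply: (measurable_OU Q hL t_ge0 (f := fun y => pw (enorm y + 1))).
    exact: continuous_ppow_enorm.
  by move=> y; exact: ppow_ge0.
have mono : (\int[P]_w (Num.min (Num.max (pw (enorm (O t w) + 1) - m%:R) 0) n%:R)%:E)%E
    @[n --> \oo] --> (\int[P]_w (Num.max (pw (enorm (O t w) + 1) - m%:R) 0)%:E)%E.
  have -> : (\int[P]_w (Num.max (pw (enorm (O t w) + 1) - m%:R) 0)%:E)%E =
    (\int[P]_w limn (fun n =>
      (Num.min (Num.max (pw (enorm (O t w) + 1) - m%:R) 0) n%:R)%:E))%E.
    apply: eq_integral => w _; apply/esym/cvg_lim => //; apply: cvg_near_cst.
    apply: filterS (near_ge_nat (Num.max (pw (enorm (O t w) + 1) - m%:R) 0)) => n hn.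
    by congr (_%:E); apply/min_idPl.
  apply: (@cvg_monotone_convergence _ _ _ P setT measurableT (fun n w =>
    (Num.min (Num.max (pw (enorm (O t w) + 1) - m%:R) 0) n%:R)%:E)).
  - by move=> n; exact/measurable_EFinP.
  - by move=> n w _; rewrite lee_fin le_min le_max lexx orbT/=.
  - by move=> w _ i j ij; rewrite lee_fin le_min !ge_min lexx/= ler_nat ij orbT.
apply: (cvge_to_le mono); apply: nearW => n.
(* Chosen so that [h (|y| - C)] is exactly the truncated excess of the power of [|y| + 1]. *)
pose h (x : R) := Num.min (Num.max (pw (x + (C + 1)) - m%:R) 0) n%:R.
have h0 x : 0 <= h x <= n%:R.
  by rewrite /h le_min le_max lexx orbT/= ler0n/= ge_min lexx orbT.
have hE : (fun w => Num.min (Num.max (pw (enorm (O t w) + 1) - m%:R) 0) n%:R) =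
    (fun w => h (enorm (O t w) - C)).
  by apply/funext => w; rewrite /h; congr (Num.min (Num.max (pw _ - _) 0) _); ring.
rewrite -EFin_Rintegral_prob; last first.
  split; first exact: mX.
  exists n%:R => w _; rewrite -[X in `|X|]/((fun w => Num.min (Num.max
    (pw (enorm (O t w) + 1) - m%:R) 0) n%:R) w) hE.
  by have /andP[h1 h2] := h0 (enorm (O t w) - C); rewrite ger0_norm.
rewrite lee_fin hE.
have hnd : {homo h : x y / x <= y}.
  move=> x y xy; rewrite /h le_min !ge_min lexx orbT andbT; apply/orP; left.
  by rewrite ge_max !le_max lexx orbT andbT lerD2r le_ppow// lerD2r.
have ch : continuous h by exact: continuous_ppow_truncated.
apply: (le_trans (dom t h n%:R tt ch hnd h0)).
have ihO : bounded_measurable setT (fun w => h (enorm (Oinf w))).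
  apply: (@bounded_measurable_Oinf _ _ _ _ _ hOinf (fun y => h (enorm y)) n%:R).
    exact: continuous_comp_enorm.
  by move=> y; have /andP[h1 h2] := h0 (enorm y); rewrite ger0_norm.
have : \int[P']_w h (enorm (Oinf w)) <=
    \int[P']_w Num.max (pw (enorm (Oinf w) + (C + 1)) - m%:R) 0.
  apply: le_Rintegral => //.
  - exact: (bounded_measurable_integrable measurableT (probability_setT_lty P') ihO).
  - apply: le_integrable (integrable_ppow_Oinf C1) => //.
      apply/measurable_EFinP; apply: measurable_maxr => //.
      by apply: measurable_funB => //; exact: measurable_ppow_Oinf.
    move=> w _ /=; rewrite lee_fin !ger0_norm ?ppow_ge0 ?le_max ?lexx ?orbT//.
    by rewrite ge_max ppow_ge0 andbT gerBl.
  - by move=> w _; rewrite /h ge_min lexx.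
move=> /le_trans/(_ (ltW hm)).
by rewrite ler_pdivlMr// mulrC.
Qed.

Let quarter_le (a b : R) : a <= b ->
  a + (b - a) / 4 + (b - a) / 4 <= b.
Proof. lra. Qed.

(** The power of [|O_t| + eta] splits into its truncation at [m], controlled by weak convergence,
    and an excess, controlled by uniform integrability. The excess is measured with 1 instead of
    [eta], so [m] does not depend on [eta]. *)
Lemma moment_upper (c : R) :
  (\int[P']_w (pw (enorm (Oinf w)))%:E < c%:E)%E ->
  exists2 eta : R, 0 < eta & \forall t \near +oo, forall a : V,
    enorm a <= eta -> (\int[P]_w (pw (enorm (a + O t w)))%:E <= c%:E)%E.
Proof.
have iO : P'.-integrable setT (EFin \o (fun w => pw (enorm (Oinf w)))).
  by have := integrable_ppow_Oinf (lexx 0); under eq_fun do rewrite addr0.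
have EE : (\int[P']_w (pw (enorm (Oinf w)))%:E)%E =
    (\int[P']_w pw (enorm (Oinf w)))%:E.
  by rewrite /Rintegral fineK//; exact: integrable_fin_num.
rewrite EE lte_fin; set E := (\int[P']_w _) => Ec.
(* One [e] pays for the shift by [eta], one for the excess. *)
pose e := (c - E) / 4; have e0 : 0 < e by rewrite divr_gt0// subr_gt0.
have Ee : E < E + e by rewrite ltrDl.
have [n hn] := Oinf_shift Ee.
have [m [t0 [t00 UI]]] := OU_uniformly_integrable e0.
set eta := n.+1%:R^-1 in hn.
have eta1 : eta <= 1 by rewrite invf_le1// ler1n.
have eta0 : 0 < eta by rewrite invr_gt0.
exists eta => //.
pose g (y : V) := Num.min (pw (enorm y + eta)) m%:R.
have cg : continuous g.
  by apply: continuous_minr; [exact: continuous_ppow_enorm | exact: cst_continuous].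
have g0 y : 0 <= g y by rewrite /g le_min ppow_ge0/=.
have gm y : `|g y| <= m%:R by rewrite ger0_norm// /g ge_min lexx orbT.
have gE : \int[P']_w g (Oinf w) < E + e.
  apply: le_lt_trans hn; apply: le_Rintegral => //.
  - exact: (bounded_measurable_integrable measurableT (probability_setT_lty P')
      (bounded_measurable_Oinf hOinf cg gm)).
  - by apply: integrable_ppow_Oinf; rewrite invr_ge0.
  - by move=> w _; rewrite /g ge_min lexx.
have near_g : \forall t \near +oo, \int[P]_w g (O t w) < E + e.
  exact: (cvgr_lt _ (Rintegral_OU_cvg hOinf hO cg gm) _ gE).
have near_t := nbhs_pinfty_ge (num_real t0).
apply: filterS2 near_g near_t => t gt tt a an.
have t_ge0 := le_trans t00 tt.
have bg := bounded_measurable_OU Q hL t_ge0 cg gm.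
have mmax : measurable_fun setT
    (fun w => Num.max (pw (enorm (O t w) + 1) - m%:R) 0).
  apply: measurable_maxr => //; apply: measurable_funB => //.
  apply: (measurable_OU Q hL t_ge0 (f := fun y => pw (enorm y + 1))).
    exact: continuous_ppow_enorm.
  by move=> y; exact: ppow_ge0.
apply: (@le_trans _ _ (\int[P]_w ((g (O t w))%:E +
    (Num.max (pw (enorm (O t w) + 1) - m%:R) 0)%:E))%E).
  apply: ge0_le_integral => //.
  - by move=> w _; rewrite lee_fin ppow_ge0.
  - by apply/measurable_EFinP; exact: (measurable_moment0 Q hL p0 a t_ge0).
  - by apply: emeasurable_funD; apply/measurable_EFinP => //; case: bg.
  - move=> w _; rewrite -EFinD lee_fin.
    have h1 : pw (enorm (a + O t w)) <= pw (enorm (O t w) + eta).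
      by apply: le_ppow => //; apply: (le_trans (enormD _ _)); rewrite addrC lerD2l.
    have h2 : pw (enorm (O t w) + eta) <= pw (enorm (O t w) + 1).
      by apply: le_ppow => //; rewrite lerD2l.
    apply: (le_trans h1); rewrite /g.
    (* Below [m] the truncation is the whole power; above, it equals [m] and the excess covers the
       rest. *)
    have [h3|h3] := leP (pw (enorm (O t w) + eta)) m%:R.
      by rewrite lerDl le_max lexx orbT.
    by rewrite -lerBlDl le_max lerD2r h2.
rewrite ge0_integralD//; last 4 first.
- by move=> w _; rewrite lee_fin.
- by apply/measurable_EFinP; case: bg.
- by move=> w _; rewrite lee_fin le_max lexx orbT.
- exact/measurable_EFinP.
have h1 : (\int[P]_w (g (O t w))%:E <= (E + e)%:E)%E.
  by rewrite -EFin_Rintegral_prob// lee_fin; exact: ltW gt.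
apply: (le_trans (leeD h1 (UI t tt))).
rewrite -EFinD lee_fin /e; exact: quarter_le (ltW Ec).
Qed.

End MomentUpper.

(** * Asymptotics of the deterministic part *)

Section LimInfSup.
Context (R : realType) (F : set_system R) (FF : ProperFilter F).
Implicit Types (f : R -> \bar R) (c : \bar R).
Local Open Scope ereal_scope.

Lemma limf_einf_ge f c : (\forall x \near F, c <= f x) -> c <= limf_einf f F.
Proof.
move=> h; rewrite limf_einfE; apply: le_trans (ereal_sup_ubound _).
  2: by exists [set x | c <= f x].
by apply: le_ereal_inf_tmp => _ [x cx <-].
Qed.

Lemma limf_esup_le f c : (\forall x \near F, f x <= c) -> limf_esup f F <= c.
Proof.
move=> h; rewrite limf_esupE; apply: le_trans (ereal_inf_lbound _) _.
  by exists [set x | f x <= c].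
by apply: ge_ereal_sup => _ [x cx <-].
Qed.

Lemma limf_einf_le_esup f : limf_einf f F <= limf_esup f F.
Proof.
rewrite limf_einfE limf_esupE; apply: ge_ereal_sup => _ [A FA <-].
apply: le_ereal_inf_tmp => _ [B FB <-].
have [x [Ax Bx]] := filter_ex (filterI FA FB).
apply: (@le_trans _ _ (f x)).
  by apply: ereal_inf_lbound; exists x.
by apply: ereal_sup_ubound; exists x.
Qed.

Lemma limf_einf_gt f c : c < limf_einf f F ->
  exists2 e, c < e & \forall x \near F, e <= f x.
Proof.
rewrite limf_einfE => /ereal_sup_gt[_ [A FA <-] cA].
exists (ereal_inf (f @` A)) => //; apply: filterS FA => x Ax.
by apply: ereal_inf_lbound; exists x.
Qed.

Lemma limf_esup_lt f c : limf_esup f F < c -> \forall x \near F, f x < c.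
Proof.
rewrite limf_esupE => /ereal_inf_lt[_ [A FA <-] cA].
apply: filterS FA => x Ax; apply: le_lt_trans cA.
by apply: ereal_sup_ubound; exists x.
Qed.

(** For [l = +oo] the second condition is vacuous, so an infinite limiting moment needs no separate
    treatment. *)
Lemma cvge_sandwich f (l : \bar R) : 0 <= l ->
  (forall c : R, c%:E < l -> \forall x \near F, c%:E <= f x) ->
  (forall c : R, l < c%:E -> \forall x \near F, f x <= c%:E) ->
  f x @[x --> F] --> l.
Proof.
case: l => [l| |//] _ lo hi; last first.
  by apply/cvgeyPge => A; apply: lo; rewrite ltry.
have fin : \forall x \near F, f x \is a fin_num.
  have h1 := lo (l - 1)%R; have h2 := hi (l + 1)%R.
  rewrite lte_fin ltrBlDr ltrDl ltr01 in h1; rewrite lte_fin ltrDl ltr01 in h2.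
  apply: filterS2 (h1 isT) (h2 isT) => x x1 x2.
  by rewrite fin_real// (lt_le_trans (ltNyr _) x1) (le_lt_trans x2 (ltry _)).
apply/fine_cvgP; split => //; apply/cvgrPdist_le => e e0.
have h1 := lo (l - e)%R; have h2 := hi (l + e)%R.
rewrite lte_fin ltrBlDr ltrDl e0 in h1; rewrite lte_fin ltrDl e0 in h2.
apply: filterS3 fin (h1 isT) (h2 isT) => x xf.
rewrite /= -(fineK xf) !lee_fin => x1 x2; rewrite ler_distlC.
by rewrite x1 x2.
Qed.

End LimInfSup.

Section ComplexNorm.
Context (R : realType) (d : nat).
Local Open Scope complex_scope.
Implicit Types (u v : 'cV[R[i]]_d) (x : 'cV[R]_d).

Lemma cnorm_ge0 v : 0 <= cnorm v.
Proof. exact: sqrtr_ge0. Qed.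

Lemma cnormD u v : cnorm (u + v) <= cnorm u + cnorm v.
Proof.
pose re_im (v : 'cV[R[i]]_d) (k : 'I_d * bool) : R :=
  if k.2 then complex.Re (v k.1 0) else complex.Im (v k.1 0).
have cE v' : cnorm v' = Num.sqrt (\sum_k re_im v' k ^+ 2).
  rewrite /cnorm -(pair_bigA _ (fun i b => re_im v' (i, b) ^+ 2))/=.
  by congr Num.sqrt; apply: eq_bigr => i _; rewrite big_bool.
rewrite !cE (eq_bigr (fun k => (re_im u k + re_im v k) ^+ 2)).
  exact: sqrt_sum_triangle.
by move=> [i b] _; rewrite /re_im/= mxE; case: (u i 0) (v i 0) b => [? ?] [? ?] [].
Qed.

Lemma cnormN v : cnorm (- v) = cnorm v.
Proof.
rewrite /cnorm; congr Num.sqrt; apply: eq_bigr => i _; rewrite mxE.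
by case: (v i 0) => a b /=; rewrite !sqrrN.
Qed.

Lemma cnorm_cmx (s : R) x : cnorm (s%:C *: cmx x) = `|s| * enorm x.
Proof.
rewrite -enormZ /cnorm /enorm; congr Num.sqrt; apply: eq_bigr => i _.
by rewrite !mxE /=; simpc; rewrite /= expr0n addr0.
Qed.

End ComplexNorm.

Section SpectralBounds.
Context (R : realType) (d : nat) (Q : 'M[R]_d) (x : 'cV[R]_d) (q : R) (l m : nat)
  (theta : 'I_m -> R) (v : 'I_m -> 'cV[R[i]]_d).
Hypothesis hsp : spectral_data Q x q l theta v.

Let b (t : R) : R := expR (q * t) / t ^+ l.-1 * enorm (expmx (- t *: Q) *m x).

(** The trigonometric sum is eventually bounded away from 0 and from above by the bounds on its
    lower and upper limits; [b t] differs from its norm by less than both 1 and half of the lower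
    bound. *)
Lemma spectral_bounds : exists c1 c2 : R, [/\ 0 < c1, 0 < c2 &
  \forall t \near +oo, c1 <= b t <= c2].
Proof.
have [e e0 hinf] := limf_einf_gt _ (spectral_liminf hsp).
have [c0 c00 hc0] : exists2 c0 : R, 0 < c0 &
    \forall t \near +oo, c0 <= cnorm (trig_sum theta v t).
  (* The extended bound [e] could be [+oo]; a finite norm cannot exceed it, so any [c0] works
     there. *)
  case: e e0 hinf => [e|_ h|//]; first by rewrite lte_fin => e0 h; exists e.
  by exists 1 => //; apply: filterS h => t; rewrite leye_eq.
pose s := \sum_(k < m) cnorm (v k).
have s0 : 0 <= s by apply: sumr_ge0 => k _; exact: cnorm_ge0.
have hsup : \forall t \near +oo, cnorm (trig_sum theta v t) < s + 1.
  have lt1 : (limf_esup (fun t => (cnorm (trig_sum theta v t))%:E) (pinfty_nbhs R)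
      < (s + 1)%:E)%E.
    by apply: le_lt_trans (spectral_limsup hsp) _; rewrite lte_fin ltrDl.
  by apply: filterS (limf_esup_lt _ lt1) => t; rewrite lte_fin.
pose r (t : R) := cnorm ((expR (q * t) / t ^+ l.-1)%:C%C *: cmx (expmx (- t *: Q) *m x)
  - trig_sum theta v t).
have hr : \forall t \near +oo, r t < Num.min 1 (c0 / 2).
  have := cvgr_lt _ (spectral_cvg hsp) (Num.min 1 (c0 / 2)).
  by apply; rewrite lt_min ltr01 divr_gt0.
exists (c0 / 2), (s + 2); split; [by rewrite divr_gt0|by rewrite ltr_wpDl|].
have t_gt0 : \forall t \near +oo, (0 : R) < t by exact: nbhs_pinfty_gt.
apply: filterS3 (filterI hc0 t_gt0) hsup hr => t [].
have split3 (u z y : R) : 0 < c0 -> c0 <= z -> z < s + 1 -> y < Num.min 1 (c0 / 2) ->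
    u <= y + z -> z <= u + y -> c0 / 2 <= u <= s + 2.
  by move=> ? ? ?; rewrite lt_min => /andP[? ?] ? ?; apply/andP; split; lra.
move=> h1 t0 h2 h3.
have bE : b t = cnorm ((expR (q * t) / t ^+ l.-1)%:C%C *: cmx (expmx (- t *: Q) *m x)).
  by rewrite cnorm_cmx ger0_norm// divr_ge0 ?expR_ge0// exprn_ge0// ltW.
rewrite bE; set u := _ *: _; set z := trig_sum theta v t.
have h4 : cnorm u <= cnorm (u - z) + cnorm z.
  by have := cnormD (u - z) z; rewrite subrK.
have h5 : cnorm z <= cnorm u + cnorm (u - z).
  rewrite -[cnorm (u - z)]cnormN opprB.
  by have := cnormD u (z - u); rewrite addrC subrK.
exact: (split3 _ _ _ c00 h1 h2 h3 h4 h5).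
Qed.

End SpectralBounds.

Section MixingTime.
Context (R : realType) (q : R) (q0 : 0 < q) (l : nat) (w : R -> R) (w0 : R)
  (hw0 : 0 < w0) (hw : w eps @[eps --> 0^'+] --> w0).

Let tau (r eps : R) := mixing_time q l eps + r * w eps.

Lemma ln_large (A : R) : \forall eps \near (0 : R)^'+, A <= - ln eps.
Proof.
near=> eps.
have e0 : 0 < eps by near: eps; exact: nbhs_right_gt.
have : eps < expR (- A) by near: eps; apply: nbhs_right_lt; exact: expR_gt0.
by move=> h; rewrite lerNr -ler_expR lnK ?posrE// ltW.
Unshelve. all: by end_near. Qed.

Lemma w_near : \forall eps \near (0 : R)^'+, w0 / 2 <= w eps <= 2 * w0.
Proof.
have h1 : \forall eps \near (0 : R)^'+, w0 / 2 <= w eps.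
  by apply: (cvgr_ge _ hw); rewrite ltr_pdivrMr// ltr_pMr// ltr1n.
have h2 : \forall eps \near (0 : R)^'+, w eps <= 2 * w0.
  by apply: (cvgr_le _ hw); rewrite ltr_pMl// ltr1n.
by apply: filterS2 h1 h2 => eps -> ->.
Qed.

(** Writing [y] as the square of its root turns a sublinear bound on [ln] into one of order
    [sqrt y], which makes the logarithmic correction negligible. *)
Lemma ln_le_sqrt (y : R) : 1 <= y -> 0 <= ln y <= 2 * Num.sqrt y.
Proof.
move=> y1; have y0 : 0 < y by exact: lt_le_trans y1.
rewrite ln_ge0//=; rewrite -{1}(sqr_sqrtr (ltW y0)) lnXn ?sqrtr_gt0//.
rewrite mulr2n mulrDl !mul1r; have s0 : 0 < Num.sqrt y by rewrite sqrtr_gt0.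
by have := ln_sublinear s0; lra.
Qed.

(** After multiplication by [q], the main term is [lam] and both corrections are at most [lam / 2]
    in size: [q r we] by the first threshold, [k ll <= 2 k s] because [lam >= 16 k^2] means
    [s >= 4 k]. The logarithmic one is nonnegative, whence the bounds [lam / 2] and [2 lam]. *)
Let tau_arith (k r lam ll s we : R) : 0 <= k -> 0 <= ll -> ll <= 2 * s ->
  0 <= s -> s ^+ 2 = lam -> w0 / 2 <= we <= 2 * w0 ->
  4 * q * `|r| * w0 <= lam -> 4 * q * `|r| * w0 + 16 * k ^+ 2 <= lam ->
  (2 * q)^-1 * lam <= q^-1 * lam + k / q * ll + r * we <= 2 / q * lam.
Proof.
move=> k0 ll0 lls s0 sE /andP[we1 we2] h1 h2.
have -> : q^-1 * lam + k / q * ll + r * we = q^-1 * (lam + k * ll + q * r * we).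
  by field; rewrite gt_eqF.
have -> : (2 * q)^-1 * lam = q^-1 * (lam / 2) by field; rewrite gt_eqF.
have -> : 2 / q * lam = q^-1 * (2 * lam) by field; rewrite gt_eqF.
rewrite !ler_pM2l ?invr_gt0//.
have we0 : 0 <= we by apply: le_trans we1; rewrite divr_ge0// ltW.
have qrw : `|q * r * we| <= lam / 2.
  rewrite !normrM (ger0_norm (ltW q0)) (ger0_norm we0).
  have : q * `|r| * we <= q * `|r| * (2 * w0).
    by rewrite ler_wpM2l// mulr_ge0// ltW.
  by lra.
move: qrw; rewrite ler_norml => /andP[qrw1 qrw2].
have kll0 : 0 <= k * ll by rewrite mulr_ge0.
have kll : k * ll <= lam / 2.
  have : k * ll <= k * (2 * s) by rewrite ler_wpM2l.
  have qr0 : 0 <= 4 * q * `|r| * w0 by rewrite !mulr_ge0// ltW.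
  have : (4 * k) ^+ 2 <= s ^+ 2 by rewrite sE exprMn -natrX; lra.
  rewrite ler_pXn2r ?nnegrE ?mulr_ge0// => ks.
  have : (4 * k) * s <= s * s by rewrite ler_wpM2r.
  by rewrite -expr2 sE; lra.
by apply/andP; split; lra.
Qed.

Lemma tau_near (r : R) : \forall eps \near (0 : R)^'+,
  [/\ 0 < eps, 1 <= - ln eps,
      tau r eps = q^-1 * - ln eps + l.-1%:R / q * ln (- ln eps) + r * w eps,
      w0 / 2 <= w eps <= 2 * w0 &
      (2 * q)^-1 * - ln eps <= tau r eps <= 2 / q * - ln eps].
Proof.
pose k : R := l.-1%:R.
have k0 : 0 <= k by [].
near=> eps.
have e0 : 0 < eps by near: eps; exact: nbhs_right_gt.
have l1 : 1 <= - ln eps by near: eps; exact: ln_large.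
have l2 : 4 * q * `|r| * w0 <= - ln eps by near: eps; exact: ln_large.
have l3 : 4 * q * `|r| * w0 + 16 * k ^+ 2 <= - ln eps by near: eps; exact: ln_large.
have hwe : w0 / 2 <= w eps <= 2 * w0 by near: eps; exact: w_near.
have tauE : tau r eps = q^-1 * - ln eps + k / q * ln (- ln eps) + r * w eps.
  rewrite /tau /mixing_time ler0_norm; first by [].
  by rewrite -oppr_ge0 (le_trans ler01).
split => //; rewrite tauE.
have /andP[ll0 ll1] := ln_le_sqrt l1.
have lam0 : 0 <= - ln eps by exact: le_trans l1.
have s2 := sqr_sqrtr lam0; have s0 := sqrtr_ge0 (- ln eps).
exact: (tau_arith k0 ll0 ll1 s0 s2 hwe l2 l3).
Unshelve. all: by end_near. Qed.

End MixingTime.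

Section DeterministicPart.
Context (R : realType) (d : nat) (Q : 'M[R]_d) (x : 'cV[R]_d) (q : R) (l m : nat)
  (theta : 'I_m -> R) (v : 'I_m -> 'cV[R[i]]_d).
Hypothesis hsp : spectral_data Q x q l theta v.
Context (w : R -> R) (w0 : R) (hw0 : 0 < w0) (hw : w eps @[eps --> 0^'+] --> w0).

Let tau (r eps : R) := mixing_time q l eps + r * w eps.

Definition drift (r eps : R) : 'cV[R]_d :=
  eps^-1 *: (expmx (- tau r eps *: Q) *m x).

Let q0 : 0 < q := spectral_q hsp.

Lemma tau_near_pinfty (r : R) (S : set R) : (\forall t \near +oo, S t) ->
  \forall eps \near (0 : R)^'+, S (tau r eps).
Proof.
move=> [M [_ hM]].
have h := ln_large (2 * q * (`|M| + 1)).
apply: filterS2 (tau_near q0 l hw0 hw r) h => eps [e0 l1 _ _ /andP[t1 _]] hl.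
apply: hM; apply: lt_le_trans t1; rewrite ltr_pdivlMl ?mulr_gt0//.
apply: lt_le_trans hl; rewrite ltr_pM2l ?mulr_gt0//.
by rewrite (le_lt_trans (ler_norm _))// ltrDl.
Qed.

(* Time change: [exp (q tau) = exp lam * lam ^ (l - 1) * exp (q r w)] with
   [lam = |ln eps|]. *)
Lemma enorm_drift (r eps lam t we c : R) : 0 < eps -> lam = - ln eps ->
  1 <= lam -> 0 < t -> t = q^-1 * lam + l.-1%:R / q * ln lam + r * we ->
  c = expR (q * t) / t ^+ l.-1 * enorm (expmx (- t *: Q) *m x) ->
  enorm (eps^-1 *: (expmx (- t *: Q) *m x)) =
  c * (t / lam) ^+ l.-1 * expR (- (q * r * we)).
Proof.
move=> e0 lamE l1 t0 tE ->; have lam0 : 0 < lam by exact: lt_le_trans l1.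
rewrite enormZ ger0_norm ?invr_ge0 ?(ltW e0)//.
have -> : eps^-1 = expR lam by rewrite lamE expRN lnK.
have -> : expR (q * t) = expR lam * lam ^+ l.-1 * expR (q * r * we).
  have -> : q * t = lam + l.-1%:R * ln lam + q * r * we.
    by rewrite tE; field; rewrite gt_eqF.
  by rewrite !expRD expRM_natl lnK.
rewrite expRN expr_div_n; field.
by rewrite !gt_eqF ?exprn_gt0// expR_gt0.
Qed.

(** The constants combine [spectral_bounds] with the two-sided bound on [tau / lam], raised to the
    power [l - 1]. They do not depend on [r], whereas the range of [eps] does. The inequality
    [w0 / 2 <= w eps] serves both signs of [r], as it reverses when multiplied by [r <= 0]. *)
Lemma drift_near : exists D1 D2 : R, [/\ 0 < D1, 0 < D2 &
  forall r, \forall eps \near (0 : R)^'+, [/\ 0 < eps, 0 <= tau r eps,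
    (0 <= r -> enorm (drift r eps) <= D2 * expR (- (q * w0 / 2 * r))) &
    (r <= 0 -> D1 * expR (- (q * w0 / 2 * r)) <= enorm (drift r eps))]].
Proof.
have [c1 [c2 [c10 c20 hb]]] := spectral_bounds hsp.
exists (c1 * (2 * q)^-1 ^+ l.-1), (c2 * (2 / q) ^+ l.-1); split.
- by rewrite mulr_gt0// exprn_gt0// invr_gt0 mulr_gt0.
- by rewrite mulr_gt0// exprn_gt0// divr_gt0.
move=> r; have hbt := tau_near_pinfty r hb.
apply: filterS2 (tau_near q0 l hw0 hw r) hbt => eps [e0 l1 tE /andP[we1 we2] /andP[t1 t2]].
move=> /andP[b1 b2].
have lam0 : 0 < - ln eps by exact: lt_le_trans l1.
have t0 : 0 < tau r eps.
  by apply: lt_le_trans t1; rewrite mulr_gt0// invr_gt0 mulr_gt0.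
have dE := enorm_drift e0 erefl l1 t0 tE erefl.
move: b1 b2; set c := _ * enorm _ in dE *; move=> b1 b2.
have rho1 : (2 * q)^-1 <= tau r eps / - ln eps by rewrite ler_pdivlMr.
have rho2 : tau r eps / - ln eps <= 2 / q by rewrite ler_pdivrMr.
have q20 : 0 <= (2 * q)^-1 by rewrite invr_ge0 mulr_ge0// ltW.
have cge0 : 0 <= c by exact: le_trans (ltW c10) b1.
have rho0 : 0 <= tau r eps / - ln eps by exact: le_trans q20 rho1.
have expE : q * w0 / 2 * r = q * (r * (w0 / 2)) by ring.
split; [by []|exact: ltW|move=> r0|move=> r0]; rewrite /drift dE.
- apply: ler_pM; [by rewrite mulr_ge0// exprn_ge0|exact: expR_ge0| |].
    apply: ler_pM; [by []|exact: exprn_ge0|by []|].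
    by apply: lerXn2r => //; rewrite nnegrE// divr_ge0// ltW.
  by rewrite ler_expR lerN2 expE -mulrA ler_pM2l// ler_wpM2l.
- apply: ler_pM; [by rewrite mulr_ge0 ?ltW// exprn_gt0// invr_gt0 mulr_gt0|exact: expR_ge0| |].
    apply: ler_pM; [exact: ltW|exact: exprn_ge0|by []|].
    by apply: lerXn2r => //; rewrite nnegrE.
  by rewrite ler_expR lerN2 expE -mulrA ler_pM2l// ler_wnM2l.
Qed.

Lemma drift_small (eta : R) : 0 < eta -> \forall r \near +oo,
  \forall eps \near (0 : R)^'+,
    [/\ 0 < eps, 0 <= tau r eps & enorm (drift r eps) <= eta].
Proof.
move=> eta0; have [D1 [D2 [D10 D20 h]]] := drift_near.
pose kap := q * w0 / 2.
have kap0 : 0 < kap by rewrite divr_gt0// mulr_gt0.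
near=> r; have r0 : 0 <= r by near: r; apply: nbhs_pinfty_ge; exact: num_real.
(* This threshold suffices by [1 + y <= expR y]. *)
have r1 : D2 / eta / kap <= r by near: r; apply: nbhs_pinfty_ge; exact: num_real.
apply: filterS (h r) => eps [e0 t0 /(_ r0) hd _]; split => //.
apply: (le_trans hd); rewrite expRN ler_pdivrMr ?expR_gt0//.
rewrite -ler_pdivrMl// mulrC; apply: le_trans (expR_ge1Dx _).
by move: r1; rewrite ler_pdivrMr// -/kap [r * kap]mulrC => r1; lra.
Unshelve. all: by end_near. Qed.

Lemma drift_large (A : R) : \forall r \near -oo,
  \forall eps \near (0 : R)^'+,
    [/\ 0 < eps, 0 <= tau r eps & A <= enorm (drift r eps)].
Proof.
have [D1 [D2 [D10 D20 h]]] := drift_near.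
pose kap := q * w0 / 2.
have kap0 : 0 < kap by rewrite divr_gt0// mulr_gt0.
near=> r; have r0 : r <= 0 by near: r; apply: nbhs_ninfty_le; exact: num_real.
have r1 : r <= - (A / D1 / kap) by near: r; apply: nbhs_ninfty_le; exact: num_real.
apply: filterS (h r) => eps [e0 t0 _ /(_ r0) hd]; split => //.
apply: le_trans hd; rewrite -ler_pdivrMl// mulrC; apply: le_trans (expR_ge1Dx _).
move: r1; rewrite lerNr ler_pdivrMr// -/kap => r1.
by rewrite mulrC in r1; lra.
Unshelve. all: by end_near. Qed.

End DeterministicPart.

(** * Rescaled moments and conclusion *)

Section RescaledMoment.
Context (R : realType) (d : nat) (dT : measure_display) (T : measurableType dT)
  (P : probability T R) (L : R -> T -> 'cV[R]_d) (Q : 'M[R]_d) (x : 'cV[R]_d)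
  (p : R) (p0 : 0 < p).
Hypothesis hL : levy_process P L.
Local Notation V := 'cV[R]_d.

(** Almost surely [Y t] is [eps] times the shifted convolution, so homogeneity of the norm brings
    out the factor [eps^p] that the rescaling cancels. *)
Lemma moment_OU_solution (eps t : R) (Y : R -> T -> V) : 0 < eps -> 0 <= t ->
  OU_solution P L Q eps x Y ->
  (((eps `^ p)^-1)%:E * 'E_P[fun om => (enorm (Y t om) `^ p)%R] =
  \int[P]_om (ppow p (enorm (eps^-1 *: (expmx (- t *: Q) *m x) + OU_conv Q L t om)))%:E)%E.
Proof.
move=> e0 t0 [mY pathY]; rewrite unlock.
set a := eps^-1 *: _.
have ep0 : 0 < eps `^ p by exact: powR_gt0.
have ma := measurable_moment0 Q hL p0 a t0.
have -> : (\int[P]_om (enorm (Y t om) `^ p)%:E =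
    \int[P]_om ((eps `^ p)%:E * (ppow p (enorm (a + OU_conv Q L t om)))%:E))%E.
  apply: ae_eq_integral => //.
  - apply/measurable_EFinP.
    have := random_vec_comp (mY t t0) (continuous_comp_enorm (@ppow_continuous _ _ p0)).
    by under eq_fun do rewrite ppowE ?enorm_ge0//.
  - apply/measurable_EFinP; exact: measurable_funM.
  - apply: filterS pathY => om [cY eqY] _.
    have rY : right_regular_vec (fun s => Y s om) by move=> k; exact: cadlag_right_regular.
    have rL : right_regular_vec (fun s => L s om) := right_regular_levy hL om.
    rewrite (OU_formula rY rL eqY t0) -EFinM; congr (_%:E).
    have -> : expmx (- t *: Q) *m x + eps *: (L t om - vint t (fun s =>
        expmx (- (t - s) *: Q) *m (Q *m L s om))) = eps *: (a + OU_conv Q L t om).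
      by rewrite [RHS]scalerDr /a scalerA mulfV ?gt_eqF// scale1r.
    rewrite enormZ (ger0_norm (ltW e0)) powRM ?enorm_ge0// ?(ltW e0)//.
    by rewrite ppowE// enorm_ge0.
rewrite ge0_integralZl//; last 3 first.
- exact/measurable_EFinP.
- by move=> om _; rewrite lee_fin ppow_ge0.
- by rewrite lee_fin ltW.
by rewrite muleA -EFinM mulVf ?gt_eqF// mul1e.
Qed.

End RescaledMoment.

Theorem corollary3p1 (R : realType) (d : nat)
    (dT : measure_display) (T : measurableType dT) (P : probability T R)
    (L : R -> T -> 'cV[R]_d) (b : 'cV[R]_d) (Sigma : 'M[R]_d)
    (nu : {measure set (borel_vec R d) -> \bar R})
    (hL : levy_process P L) (hLtr : levy_triplet P L b Sigma nu)
    (p : R) (hp : 0 < p)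
    (hnu : (\int[nu]_(z in [set z : borel_vec R d | (1 < enorm (z : 'cV[R]_d))%R])
              (enorm (z : 'cV[R]_d) `^ p)%R%:E < +oo)%E)
    (Q : 'M[R]_d)
    (hQ : forall lam : R[i], eigenvalue (cmx Q) lam -> 0 < complex.Re lam)
    (x : 'cV[R]_d) (hx : x != 0)
    (q : R) (l m : nat) (theta : 'I_m -> R) (v : 'I_m -> 'cV[R[i]]_d)
    (hsp : spectral_data Q x q l theta v)
    (X : R -> R -> T -> 'cV[R]_d)
    (hX : forall eps : R, 0 < eps -> OU_solution P L Q eps x (X eps))
    (dT' : measure_display) (T' : measurableType dT') (P' : probability T' R)
    (Oinf : T' -> 'cV[R]_d) (hOinf : random_vec Oinf)
    (hO : cvg_in_distribution P P' (OU_conv Q L) Oinf)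
    (w : R -> R) (w0 : R) (hw0 : 0 < w0) (hw : w eps @[eps --> 0^'+] --> w0)
    (p' : R) (hp' : 0 < p' <= p) :
  [/\ limf_einf (rescaled_moment P X p' q l w r) 0^'+ @[r --> +oo]
        --> 'E_P'[fun om => (enorm (Oinf om) `^ p')%R]%E,
      limf_esup (rescaled_moment P X p' q l w r) 0^'+ @[r --> +oo]
        --> 'E_P'[fun om => (enorm (Oinf om) `^ p')%R]%E,
      limf_einf (rescaled_moment P X p' q l w r) 0^'+ @[r --> -oo] --> +oo%E
    & limf_esup (rescaled_moment P X p' q l w r) 0^'+ @[r --> -oo] --> +oo%E].
Proof.
case/andP: hp' => p'0 _.
pose drf := drift Q x q l w.
pose tau r eps := mixing_time q l eps + r * w eps.
have EE : ('E_P'[fun om => (enorm (Oinf om) `^ p')%R] =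
    \int[P']_om (ppow p' (enorm (Oinf om)))%:E)%E.
  by rewrite unlock; apply: eq_integral => om _; rewrite ppowE// enorm_ge0.
have mE r eps : 0 < eps -> 0 <= tau r eps ->
    rescaled_moment P X p' q l w r eps =
    (\int[P]_om (ppow p' (enorm (drf r eps + OU_conv Q L (tau r eps) om)))%:E)%E.
  by move=> e0 t0; apply: moment_OU_solution => //; exact: hX.
have tau_inf := tau_near_pinfty hsp hw0 hw.
(* [eta] is fixed first, then [r] is taken so large that the drift stays below [eta] for all small
   [eps]; only then does [eps] tend to 0, which sends the time to infinity with [r] fixed. *)
have lower (c : R) : (c%:E < \int[P']_om (ppow p' (enorm (Oinf om)))%:E)%E ->
    \forall r \near +oo, (c%:E <= limf_einf (rescaled_moment P X p' q l w r) 0^'+)%E.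
  move=> cE; have [eta eta0 hc] := moment_lower hL hOinf hO p'0 cE.
  apply: filterS (drift_small hsp hw0 hw eta0) => r hr.
  apply: limf_einf_ge; apply: filterS2 hr (tau_inf r _ hc) => eps [e0 t0 he] ht.
  by rewrite mE//; exact: ht.
have upper (c : R) : (\int[P']_om (ppow p' (enorm (Oinf om)))%:E < c%:E)%E ->
    \forall r \near +oo, (limf_esup (rescaled_moment P X p' q l w r) 0^'+ <= c%:E)%E.
  move=> cE.
  have Efin : (\int[P']_om (ppow p' (enorm (Oinf om)))%:E < +oo)%E.
    by apply: lt_trans cE _; exact: ltry.
  have [eta eta0 hc] := moment_upper hL hOinf hO p'0 Efin cE.
  apply: filterS (drift_small hsp hw0 hw eta0) => r hr.
  apply: limf_esup_le; apply: filterS2 hr (tau_inf r _ hc) => eps [e0 t0 he] ht.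
  by rewrite mE//; exact: ht.
have large (c : R) :
    \forall r \near -oo, (c%:E <= limf_einf (rescaled_moment P X p' q l w r) 0^'+)%E.
  have [A hA] := moment_large hL hOinf hO p'0 c.
  apply: filterS (drift_large hsp hw0 hw A) => r hr.
  apply: limf_einf_ge; apply: filterS2 hr (tau_inf r _ hA) => eps [e0 t0 he] ht.
  by rewrite mE//; exact: ht.
have E0 : (0 <= \int[P']_om (ppow p' (enorm (Oinf om)))%:E)%E.
  by apply: integral_ge0 => om _; rewrite lee_fin ppow_ge0.
have einf_esup r : (limf_einf (rescaled_moment P X p' q l w r) 0^'+ <=
    limf_esup (rescaled_moment P X p' q l w r) 0^'+)%E.
  exact: limf_einf_le_esup.
(* The lower limit inherits its upper bounds from the upper limit, and conversely. *)
rewrite EE; split.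
- apply: (cvge_sandwich _ E0 lower) => c cE.
  by apply: filterS (upper c cE) => r; exact: le_trans (einf_esup r).
- apply: (cvge_sandwich _ E0 _ upper) => c cE.
  by apply: filterS (lower c cE) => r /le_trans; apply.
- by apply/cvgeyPge => c; exact: large.
- by apply/cvgeyPge => c; apply: filterS (large c) => r /le_trans; apply.
Qed.
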